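(* Let $\mathcal{P}=\mathcal{P}'\uplus\{\ell\to\{p_1:r_1,\dots,p_k:r_k\}^m\}$ be an ADP problem, let $1\le j\le k$ and $\tau\in\mathrm{pos}_{\mathcal{D}}(r_j)$ with $r_j|_\tau\in\mathcal{T}(\Sigma,\mathcal{V})$ (no annotation at or below $\tau$), and suppose $r_j\hookrightarrow^{\mathsf{true}}_{\mathcal{P},\tau}\{q_1:e_1,\dots,q_h:e_h\}$. Let $\mathcal{P}''=\mathcal{P}'\cup\{\ell\to\{p_1:\flat(r_1),\dots,p_k:\flat(r_k)\}^m,\ \ell\to(\{p_1:r_1,\dots,p_k:r_k\}\setminus\{p_j:r_j\})\cup\{p_j\cdot q_1:e_1,\dots,p_j\cdot q_h:e_h\}^m\}$. Suppose one of the following holds: (1) $\mathcal{U}_{\mathcal{P}}(r_j|_\tau)$ is non-overlapping, and the ADP used for rewriting $r_j|_\tau$ is linear and non-erasing; (2) $\mathcal{U}_{\mathcal{P}}(r_j|_\tau)$ is non-overlapping, and all its ADPs have the form $\ell'\to\{1:r'\}^{\mathsf{true}}$; (3) $\mathcal{U}_{\mathcal{P}}(r_j|_\tau)$ is non-overlapping, $r_j|_\tau$ is a ground term, and $r_j\hookrightarrow_{\mathcal{P},\tau}\{q_1:e_1,\dots,q_h:e_h\}$ is an innermost step (i.e., additionally $r_j|_\tau\in\mathtt{ANF}_{\mathcal{P}}$). Then if $\mathcal{P}''$ is iAST, $\mathcal{P}$ is iAST (i.e., the rewriting processor $\mathrm{Proc}_{\mathtt{r}}(\mathcal{P})=\{\mathcal{P}''\}$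 is sound).
   Context: Fix a finite signature $\Sigma=\mathcal{D}\uplus\mathcal{C}$ (defined symbols and constructors) and a set of variables $\mathcal{V}$; all left-hand sides of ADPs have root in $\mathcal{D}$. For each $f\in\mathcal{D}$ let $f^\#$ be a fresh symbol of the same arity, $\mathcal{D}^\#=\{f^\#\mid f\in\mathcal{D}\}$, $\Sigma^\#=\Sigma\uplus\mathcal{D}^\#$; elements of $\mathcal{T}(\Sigma^\#,\mathcal{V})$ are annotated terms. $\mathrm{pos}_{\Sigma'}(t)$ is the set of positions of $t$ carrying a symbol of $\Sigma'$. $\flat(t)$ removes all annotations from $t$ (applied termwise to multi-distributions); $\flat_{\uparrow\pi}(t)$ removes all annotations strictly above position $\pi$. A finite multi-distribution on $A\neq\emptyset$ is a finite multiset $\mu$ of pairs $(p:a)$, $0<p\le1$, $a\in A$, with probabilities summing to 1; $\mathrm{Supp}(\mu)$ is its multiset of elements. An ADP is $\ell\to\{p_1:r_1,\dots,p_k:r_k\}^m$ with $\ell\in\mathcal{T}(\Sigma,\mathcal{V})\setminus\mathcal{V}$, $m\in\{\mathsf{true},\mathsf{false}\}$, $\{p_1:r_1,\dots,p_k:r_k\}$ a finite multi-distribution on $\mathcal{T}(\Sigma^\#,\mathcal{V})$, $\mathcal{V}(r_j)\subseteq\mathcal{V}(\ell)$. An ADP problem is a finite set $\mathcal{P}$ of ADPs. An annotated term $t$ is a $\mathcal{P}$-normal form if no subterm of $\flat(t)$ is an instance of a left-hand side of $\mathcal{P}$; $\mathtt{ANF}_{\mathcal{P}}$ is the set of annotated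 terms whose proper subterms are all $\mathcal{P}$-normal forms. $s\hookrightarrow_{\mathcal{P},\pi}\{p_1:t_1,\dots,p_k:t_k\}$ (also written without $\pi$) holds if there are an ADP $\ell\to\{p_1:r_1,\dots,p_k:r_k\}^m\in\mathcal{P}$ and a substitution $\sigma$ with $\pi\in\mathrm{pos}_{\mathcal{D}\cup\mathcal{D}^\#}(s)$, $\flat(s|_\pi)=\ell\sigma\in\mathtt{ANF}_{\mathcal{P}}$, such that for all $j$: (pr) $t_j=s[r_j\sigma]_\pi$ if $\pi\in\mathrm{pos}_{\mathcal{D}^\#}(s)$, $m=\mathsf{true}$; (p) $t_j=\flat_{\uparrow\pi}(s[r_j\sigma]_\pi)$ if $\pi\in\mathrm{pos}_{\mathcal{D}^\#}(s)$, $m=\mathsf{false}$; (r) $t_j=s[\flat(r_j)\sigma]_\pi$ if $\pi\notin\mathrm{pos}_{\mathcal{D}^\#}(s)$, $m=\mathsf{true}$; (irr) $t_j=\flat_{\uparrow\pi}(s[\flat(r_j)\sigma]_\pi)$ if $\pi\notin\mathrm{pos}_{\mathcal{D}^\#}(s)$, $m=\mathsf{false}$. The relation $\hookrightarrow^{\mathsf{true}}_{\mathcal{P},\pi}$ is defined in the same way, except that the redex $\flat(s|_\pi)=\ell\sigma$ need not be in $\mathtt{ANF}_{\mathcal{P}}$ and the applied ADP must have flag $m=\mathsf{true}$. A $\mathcal{P}$-chain tree (CT) is $\mathfrak{T}=(V,E,L,V_P)$: (1) $(V,E)$ a (possibly infinite) directed tree, $V\neq\emptyset$, every node with finitely many children;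 (2) $L$ labels each node $v$ with $(p_v,t_v)\in(0,1]\times\mathcal{T}(\Sigma^\#,\mathcal{V})$, $p_v=1$ at the root; (3) $V_P$ is a set of inner nodes, $V_R$ the remaining inner nodes; (4) if $v\in V_P$ has children $w_1,\dots,w_k$ then $t_v\hookrightarrow_{\mathcal{P}}\{\frac{p_{w_1}}{p_v}:t_{w_1},\dots,\frac{p_{w_k}}{p_v}:t_{w_k}\}$ by case (pr) or (p); (5) likewise for $v\in V_R$ by case (r) or (irr); (6) every infinite path contains infinitely many nodes of $V_P$. $|\mathfrak{T}|_{\mathtt{Leaf}}$ is the sum of $p_v$ over all leaves. $\mathcal{P}$ is iAST if $|\mathfrak{T}|_{\mathtt{Leaf}}=1$ for every $\mathcal{P}$-CT. Usable rules: $\mathrm{Rules}_{\mathcal{P}}(f)=\{\ell\to\mu^{\mathsf{true}}\in\mathcal{P}\mid\mathrm{root}(\ell)=f\}$; $\mathcal{U}_{\mathcal{P}}(t)$ is the smallest set with $\mathcal{U}_{\mathcal{P}}(x)=\emptyset$ for $x\in\mathcal{V}$ and $\mathcal{U}_{\mathcal{P}}(f(t_1,\dots,t_n))=\mathrm{Rules}_{\mathcal{P}}(f)\cup\bigcup_i\mathcal{U}_{\mathcal{P}}(t_i)\cup\bigcup_{\ell\to\mu^{\mathsf{true}}\in\mathrm{Rules}_{\mathcal{P}}(f),\,r\in\mathrm{Supp}(\mu)}\mathcal{U}_{\mathcal{P}}(\flat(r))$. A set of ADPs is non-overlapping (NO) if, viewed as rules $\ell\to\dots$, their left-hand sides have no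 overlaps (no left-hand side unifies, after variable renaming, with a non-variable subterm of a left-hand side, except a left-hand side with itself at the root). An ADP $\ell\to\mu^m$ is linear (L) if every variable occurs at most once in $\ell$ and at most once in each term of $\mathrm{Supp}(\mu)$, and non-erasing (NE) if every variable of $\ell$ occurs in each term of $\mathrm{Supp}(\mu)$. *)

(* Defs.v *)
From HB Require Import structures.
From mathcomp Require Import all_boot all_order all_algebra.
From mathcomp Require Import finmap multiset.
From mathcomp Require Import all_classical all_reals all_analysis.

Set Implicit Arguments.
Unset Strict Implicit.
Unset Printing Implicit Defensive.

Import Order.TTheory GRing.Theory Num.Theory.

Local Open Scope mset_scope.
Local Open Scope classical_set_scope.
Local Open Scope ring_scope.

Record signature := Signature {
  defined : finType;
  constr : finType;
  ar_def : defined -> nat;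
  ar_con : constr -> nat }.

(* The symbols of the annotated signature; [Ann f] is the fresh symbol f#. *)
Inductive sym (S : signature) :=
  | Con of constr S
  | Def of defined S
  | Ann of defined S.

Arguments Con {S} c.
Arguments Def {S} f.
Arguments Ann {S} f.

Definition arity (S : signature) (g : sym S) : nat :=
  match g with
  | Con c => ar_con c
  | Def f => ar_def f
  | Ann f => ar_def f
  end.

(* All annotated terms. Terms over the plain signature are the elements that
   satisfy [unannotated] below. *)
Inductive term (S : signature) (V : choiceType) :=
  | Var of V
  | App (g : sym S) of ('I_(arity g) -> term S V).

Arguments Var {S V} x.
Arguments App {S V} g ts.

HB.instance Definition _ (S : signature) (V : choiceType) :=
  gen_eqMixin (term S V).
HB.instance Definition _ (S : signature) (V : choiceType) :=
  gen_choiceMixin (term S V).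

(* Positions; arguments are counted from 0. *)
Definition position := seq nat.

Section Terms.
Context {S : signature} {V : choiceType}.
Implicit Types (t u : term S V) (p : position).

Fixpoint subterm t p : option (term S V) :=
  match p with
  | [::] => Some t
  | i :: p' =>
      match t with
      | Var _ => None
      | App g ts => if insub i is Some j then subterm (ts j) p' else None
      end
  end.

(* t[u]_p; the result is only meaningful when p is a position of t *)
Fixpoint replace t p u : term S V :=
  match p with
  | [::] => u
  | i :: p' =>
      match t with
      | Var x => Var x
      | App g ts =>
          App g (fun j => if val j == i then replace (ts j) p' u else ts j)
      end
  end.

Fixpoint subst (s : V -> term S V) t : term S V :=
  match t with
  | Var x => s x
  | App g ts => App g (fun i => subst s (ts i))
  end.

Definition root_sym t : option (sym S) :=
  if t is App g _ then Some g else None.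

Definition pos_def t p : Prop :=
  exists f : defined S, obind root_sym (subterm t p) = Some (Def f).

Definition pos_ann t p : Prop :=
  exists f : defined S, obind root_sym (subterm t p) = Some (Ann f).

Definition unannotated t : Prop := forall p, ~ pos_ann t p.

Definition vars t : set V := [set x | exists p, subterm t p = Some (Var x)].

Definition ground t : Prop := vars t = set0.

Definition linear_term t : Prop :=
  forall x p q, subterm t p = Some (Var x) -> subterm t q = Some (Var x) ->
    p = q.

Definition unann_app (g : sym S) : ('I_(arity g) -> term S V) -> term S V :=
  match g return ('I_(arity g) -> term S V) -> term S V with
  | Con c => fun ts => App (Con c) ts
  | Def f => fun ts => App (Def f) ts
  | Ann f => fun ts => App (Def f) ts
  end.

Fixpoint flat t : term S V :=
  match t with
  | Var x => Var x
  | App g ts => unann_app (fun i => flat (ts i))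
  end.

Fixpoint flat_above p t : term S V :=
  match p with
  | [::] => t
  | i :: p' =>
      match t with
      | Var x => Var x
      | App g ts =>
          unann_app (fun j => if val j == i then flat_above p' (ts j) else ts j)
      end
  end.

(* l unifies, after renaming its variables apart from those of l', with the
   subterm u of l' *)
Definition unifies_apart (l l' u : term S V) : Prop :=
  exists rho : V -> V,
    [/\ set_inj (vars l) rho,
        rho @` vars l `&` vars l' = set0
      & exists s : V -> term S V,
          subst s (subst (fun x => Var (rho x)) l) = subst s u].

End Terms.

Definition mset_map (A B : choiceType) (f : A -> B) (mu : {mset A}) : {mset B} :=
  seq_mset [seq f a | a <- mu].

Definition multidist (R : realType) (A : choiceType) (mu : {mset (R * A)%type})
    : Prop :=
  (forall x, x \in mu -> 0 < x.1 <= 1) /\ \sum_(x <- mu) x.1 = 1.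

(* Raw triples l -> mu^m; see [is_adp] for the conditions. *)
Record adp (R : realType) (S : signature) (V : choiceType) := Adp {
  lhs : term S V;
  rhs : {mset (R * term S V)%type};
  flag : bool }.

HB.instance Definition _ (R : realType) (S : signature) (V : choiceType) :=
  gen_eqMixin (adp R S V).
HB.instance Definition _ (R : realType) (S : signature) (V : choiceType) :=
  gen_choiceMixin (adp R S V).

Section ADPs.
Context {R : realType} {S : signature} {V : choiceType}.
Implicit Types (t s : term S V) (pi : position) (a b : adp R S V).
Implicit Types (mu : {mset (R * term S V)%type}) (P : {fset adp R S V}).

Definition is_adp a : Prop :=
  [/\ exists f, root_sym (lhs a) = Some (Def f),
      unannotated (lhs a),
      multidist (rhs a)
    & forall x, x \in rhs a -> vars x.2 `<=` vars (lhs a)].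

Definition adp_problem P : Prop := forall a, a \in P -> is_adp a.

Definition flat_mdist mu := mset_map (fun x => (x.1, flat x.2)) mu.

Definition normal_form P t : Prop :=
  forall p u, subterm (flat t) p = Some u ->
    ~ exists a (sg : V -> term S V), a \in P /\ u = subst sg (lhs a).

Definition ANF P : set (term S V) :=
  [set t | forall p u, p != [::] -> subterm t p = Some u -> normal_form P u].

(* The reduct t_j for the right-hand side r. The four cases, in order:
   (pr), (p), (r), (irr). *)
Definition reduct s pi (annotated m : bool) (sg : V -> term S V) (r : term S V)
    : term S V :=
  match annotated, m with
  | true, true => replace s pi (subst sg r)
  | true, false => flat_above pi (replace s pi (subst sg r))
  | false, true => replace s pi (subst sg (flat r))
  | false, false => flat_above pi (replace s pi (subst sg (flat r)))
  end.

(* No innermost condition on the redex yet; see [istep] and [tstep_by]. *)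
Definition rewrites a (sg : V -> term S V) s pi mu : Prop :=
  [/\ pos_def s pi \/ pos_ann s pi,
      omap flat (subterm s pi) = Some (subst sg (lhs a))
    & mu = mset_map
             (fun x => (x.1, reduct s pi `[< pos_ann s pi >] (flag a) sg x.2))
             (rhs a)].

Definition istep P s pi mu : Prop :=
  exists a (sg : V -> term S V),
    [/\ a \in P, ANF P (subst sg (lhs a)) & rewrites a sg s pi mu].

(* The relation with superscript true; the applied ADP is exposed. *)
Definition tstep_by P a s pi mu : Prop :=
  exists sg : V -> term S V,
    [/\ a \in P, flag a = true & rewrites a sg s pi mu].

Definition children (N : choiceType) (e : rel N) (v : N) : set N :=
  [set w | e v w].

Definition inner (N : choiceType) (e : rel N) : set N :=
  [set v | children e v !=set0].

(* only meaningful if v has finitely many children *)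
Definition children_mset (N : choiceType) (e : rel N) (p : N -> R)
    (t : N -> term S V) (v : N) : {mset (R * term S V)%type} :=
  seq_mset [seq (p w / p v, t w) | w <- fset_set (children e v)].

(* A directed tree is rendered as a graph with a node from which every node is
   reached by exactly one path. *)
Record chain_tree P := ChainTree {
  node : choiceType;
  edge : rel node;
  troot : node;
  prob : node -> R;
  label : node -> term S V;
  nodeP : set node;
  ct_tree : forall v, exists! q : seq node, path edge troot q /\ last troot q = v;
  ct_fin : forall v, finite_set (children edge v);
  ct_prob : forall v, 0 < prob v <= 1;
  ct_prob_root : prob troot = 1;
  ct_nodeP : nodeP `<=` inner edge;
  ct_stepP : forall v, nodeP v ->
    exists2 pi, pos_ann (label v) pi &
      istep P (label v) pi (children_mset edge prob label v);
  ct_stepR : forall v, (inner edge `\` nodeP) v ->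
    exists2 pi, ~ pos_ann (label v) pi &
      istep P (label v) pi (children_mset edge prob label v);
  ct_inf : forall w : nat -> node, (forall n, edge (w n) (w n.+1)) ->
    infinite_set [set n | nodeP (w n)] }.

Arguments edge {P} c.
Arguments prob {P c}.

Definition leaves P (T : chain_tree P) : set (node T) := ~` inner (edge T).
Arguments leaves {P} T.

Definition leaf_mass P (T : chain_tree P) : \bar R :=
  \esum_(v in leaves T) (prob v)%:E.

Definition iAST P : Prop := forall T : chain_tree P, leaf_mass T = 1%E.

Definition rules P (g : sym S) : set (adp R S V) :=
  [set a | [/\ a \in P, flag a = true & root_sym (lhs a) = Some g]].

Inductive usable P : term S V -> set (adp R S V) :=
  | usable_root g ts a : rules P g a -> usable P (App g ts) a
  | usable_arg g ts i a : usable P (ts i) a -> usable P (App g ts) a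
  | usable_rhs g ts b x a : rules P g b -> x \in rhs b ->
      usable P (flat x.2) a -> usable P (App g ts) a.

(* ADPs are compared as probabilistic rules, i.e. up to annotations. *)
Definition same_rule a b : Prop :=
  lhs a = lhs b /\ flat_mdist (rhs a) = flat_mdist (rhs b).

(* Distinct rules may not even overlap at the root, also if they share their
   left-hand side. *)
Definition non_overlapping (A : set (adp R S V)) : Prop :=
  forall a b p u, A a -> A b ->
    subterm (lhs b) p = Some u -> root_sym u <> None ->
    unifies_apart (lhs a) (lhs b) u -> same_rule a b /\ p = [::].

Definition linear_adp a : Prop :=
  linear_term (lhs a) /\ forall x, x \in rhs a -> linear_term x.2.

Definition non_erasing a : Prop :=
  forall x, x \in rhs a -> vars (lhs a) `<=` vars x.2.

Definition deterministic a : Prop :=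
  flag a = true /\ exists r, rhs a = [mset (1, r)]%mset.

Definition flat_adp a : adp R S V := Adp (lhs a) (flat_mdist (rhs a)) (flag a).

(* replaces one occurrence of (pj : rj) by the (pj * q : e) with (q : e) in mu *)
Definition rewritten_adp a (pj : R) (rj : term S V) mu : adp R S V :=
  Adp (lhs a)
      (rhs a `\ (pj, rj) `+` mset_map (fun x => (pj * x.1, x.2)) mu)%mset
      (flag a).

End ADPs.

Arguments edge {R S V P} c.
Arguments prob {R S V P c}.
Arguments leaves {R S V P} T.

(* Main.v *)
(* A chain tree is treated as a transition system whose states carry terms;
   [mass n x] is the probability of reaching a leaf from [x] within [n] steps.
   A chain tree of leaf mass below 1 gives a bound [b < 1] on all [mass n], and
   this bound is carried over from [P] to [P''] by simulations.

   First, every R-step whose ADP has flag false, or which takes place below no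
   annotation, is skipped: afterwards no annotation is left above it, so nothing at
   or above that position matters any more, and the simulating system just follows
   a successor of minimal leaf mass.  From then on all R-steps use flag true.

   When [alpha] is applied at an annotated position, the instance [l' th] of
   [r_j|_tau] is unannotated, and nothing above it is rewritten before its root is.
   In cases (1) and (3) non-overlappingness confines the steps before the root step
   to [th].  The system for [P''] draws the outcome of the root step at once,
   mimics the steps inside [th] (there is exactly one copy of each, or there are no
   such steps), and follows the drawn branch when the root step comes.  Averaging
   over the draws gives back the original leaf mass.  In case (2) the evaluation of
   [l' th] is deterministic; the system for [P''] leaves its contractum untouched
   until the original subterm reaches a normal form [u], and then evaluates the
   contractum to [u], which is possible by confluence. *)
Require Import Defs.
From mathcomp Require Import all_boot all_order all_algebra.
From mathcomp Require Import finmap multiset.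
From mathcomp Require Import all_classical all_reals all_analysis.

Set Implicit Arguments.
Unset Strict Implicit.
Unset Printing Implicit Defensive.

Import Order.TTheory GRing.Theory Num.Theory.

Local Open Scope mset_scope.
Local Open Scope classical_set_scope.
Local Open Scope ring_scope.

(** * Terms, positions and substitutions *)

Section TermTheory.
Context {S : signature} {V : choiceType}.
Implicit Types (t u s e : term S V) (p q : position).

(** Usable rules are ADPs with flag true. Non-overlappingness therefore says nothing about R-steps
    with flag false, and these have to disappear before the redexes inside an instance of [r_j|_tau]
    can be analysed.

    Condition (6) on infinite paths becomes well-foundedness of R-steps. This is what allows the
    simulating system to absorb steps: absorbed steps are R-steps, so only finitely many follow each
    other. Conversely, a step may be preceded by finitely many extra steps of probability 1.

    Several redexes created by [alpha] can wait at the same time, always at parallel positions. A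
    marking of positions records them together with the drawn outcomes.

    The two ADPs that replace [alpha] divide its work: the flattened one serves unannotated
    positions, the rewritten one annotated positions. *)

Lemma eq_App (g : sym S) (ts us : 'I_(arity g) -> term S V) :
  (forall i, ts i = us i) -> App g ts = App g us.
Proof. by move=> tus; congr App; apply: funext. Qed.

Lemma subterm_nil t : subterm t [::] = Some t.
Proof. by case: t. Qed.

Lemma replace_nil t e : replace t [::] e = e.
Proof. by case: t. Qed.

Lemma flat_above_nil t : flat_above [::] t = t.
Proof. by case: t. Qed.

Lemma subterm_cat t p q :
  subterm t (p ++ q) = obind (subterm^~ q) (subterm t p).
Proof.
elim: p t => [|i p IH] [x|g ts] //=.
by case: insubP => [j _ _|_] //=; rewrite IH.
Qed.

Lemma subterm_App (g : sym S) (ts : 'I_(arity g) -> term S V) (i : 'I_(arity g)) p :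
  subterm (App g ts) (val i :: p) = subterm (ts i) p.
Proof. by rewrite /= valK. Qed.

(** The arguments depend on [g], so they are compared through the subterms at positions of length
    one instead of by injection on dependent pairs. *)
Lemma App_inj (g : sym S) (ts us : 'I_(arity g) -> term S V) :
  App g ts = App g us -> ts = us.
Proof.
move=> e; apply: funext => i.
have : subterm (App g ts) [:: val i] = subterm (App g us) [:: val i] by rewrite e.
by rewrite !subterm_App !subterm_nil => -[].
Qed.

Lemma subterm_cons (g : sym S) (ts : 'I_(arity g) -> term S V) n p s :
  subterm (App g ts) (n :: p) = Some s ->
  exists2 i : 'I_(arity g), n = val i & subterm (ts i) p = Some s.
Proof. by rewrite /=; case: insubP => // i _ <- ?; exists i. Qed.

Lemma replace_App (g : sym S) (ts : 'I_(arity g) -> term S V) (i : 'I_(arity g)) p e :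
  replace (App g ts) (val i :: p) e =
  App g (fun j => if j == i then replace (ts j) p e else ts j).
Proof. by []. Qed.

Lemma replace_cat t p q u e :
  subterm t p = Some u -> replace t (p ++ q) e = replace t p (replace u q e).
Proof.
elim: p t => [|n p IH] t; first by rewrite ?cat0s subterm_nil => -[->]; rewrite ?subterm_nil ?replace_nil.
case: t => [x|g ts] // /subterm_cons[i -> tp].
rewrite cat_cons !replace_App; apply: eq_App => j.
by case: eqP => [->|//]; rewrite IH.
Qed.

Lemma subterm_replace t p q u e :
  subterm t p = Some u -> subterm (replace t p e) (p ++ q) = subterm e q.
Proof.
elim: p t => [|n p IH] t; first by rewrite ?cat0s subterm_nil => -[->]; rewrite ?subterm_nil ?replace_nil.
case: t => [x|g ts] // /subterm_cons[i -> tp].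
by rewrite cat_cons replace_App subterm_App eqxx IH.
Qed.

Lemma subterm_replace_eq t p u e :
  subterm t p = Some u -> subterm (replace t p e) p = Some e.
Proof. by move=> tp; rewrite -[X in subterm _ X]cats0 (subterm_replace _ _ tp) subterm_nil. Qed.

Lemma subterm_replace_above t p q u e :
  subterm t p = Some u ->
  subterm (replace t (p ++ q) e) p = Some (replace u q e).
Proof. by move=> tp; rewrite (replace_cat _ _ tp) (subterm_replace_eq _ tp). Qed.

Lemma replace_replace t p u e e' :
  subterm t p = Some u -> replace (replace t p e) p e' = replace t p e'.
Proof.
elim: p t => [|n p IH] t; first by rewrite ?cat0s subterm_nil => -[->]; rewrite ?subterm_nil ?replace_nil.
case: t => [x|g ts] // /subterm_cons[i -> tp].
rewrite !replace_App; apply: eq_App => j.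
by case: eqP => [->|//]; rewrite IH.
Qed.

Lemma replace_id t p u : subterm t p = Some u -> replace t p u = t.
Proof.
elim: p t => [|n p IH] t; first by rewrite ?cat0s subterm_nil => -[->]; rewrite ?subterm_nil ?replace_nil.
case: t => [x|g ts] // /subterm_cons[i -> tp].
by rewrite !replace_App; apply: eq_App => j; case: eqP => [->|//]; rewrite IH.
Qed.

Definition par p q : bool := ~~ prefix p q && ~~ prefix q p.

Lemma par_sym p q : par p q = par q p.
Proof. exact: andbC. Qed.

Lemma par_cons i j p q : par (i :: p) (j :: q) = (i != j) || par p q.
Proof.
by rewrite /par !prefix_cons [j == i]eq_sym; case: eqP.
Qed.

Lemma par0s q : par [::] q = false.
Proof. by case: q. Qed.

Lemma pars0 q : par q [::] = false.
Proof. by rewrite par_sym par0s. Qed.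

Lemma pos_cases p q :
  par p q \/ (exists r, q = p ++ r) \/ (exists i r, p = q ++ i :: r).
Proof.
case: (boolP (prefix p q)) => [/prefixP[r ->]|npq]; first by right; left; exists r.
case: (boolP (prefix q p)) => [/prefixP[r pE]|nqp].
  right; right; case: r pE => [|i r] pE; last by exists i, r.
  by rewrite pE cats0 prefix_refl in npq.
by left; rewrite /par npq nqp.
Qed.

Lemma subterm_replace_par t p q e :
  par p q -> subterm (replace t p e) q = subterm t q.
Proof.
elim: p t q => [|i p IH] t [|j q]; rewrite ?par_cons ?par0s ?pars0 //.
case: t => [x|g ts] //= ijp; case: insubP => // k _ kj.
by rewrite kj [j == i]eq_sym; case: eqVneq ijp => //= _ /IH ->.
Qed.

Lemma replace_par t p q u v e e' :
  par p q -> subterm t p = Some u -> subterm t q = Some v ->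
  replace (replace t p e) q e' = replace (replace t q e') p e.
Proof.
elim: p t q => [|n p IH] t [|m q]; rewrite ?par_cons ?par0s ?pars0 //.
case: t => [x|g ts] // ijp /subterm_cons[i ni tp] /subterm_cons[j mj tq].
subst n m; rewrite !replace_App; apply: eq_App => k.
have [ki|ki] := eqVneq k i; have [kj|kj] //= := eqVneq k j.
by subst k j; rewrite eqxx /= in ijp; apply: IH.
Qed.

Lemma subterm_unann_cons (g : sym S) (ts : 'I_(arity g) -> term S V) i p :
  subterm (unann_app ts) (i :: p) = subterm (App g ts) (i :: p).
Proof. by case: g ts. Qed.

Lemma root_unann (g : sym S) (ts : 'I_(arity g) -> term S V) f :
  root_sym (unann_app ts) <> Some (Ann f).
Proof. by case: g ts. Qed.

Lemma subterm_flat t p : subterm (flat t) p = omap flat (subterm t p).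
Proof.
elim: p t => [|i p IH] t; first by rewrite !subterm_nil.
case: t => [x|g ts] //.
by rewrite [flat _]/= subterm_unann_cons /=; case: insub => //=.
Qed.

Lemma flat_unann (g : sym S) (ts : 'I_(arity g) -> term S V) :
  flat (unann_app ts) = flat (App g ts).
Proof. by case: g ts. Qed.

Lemma flat_flat t : flat (flat t) = flat t.
Proof.
elim: t => [//|g ts IH] /=; rewrite flat_unann /=; congr (unann_app _).
by apply: funext => i.
Qed.

Lemma unann_flatP t : unannotated t <-> flat t = t.
Proof.
split; last first.
  move=> tE p [f]; rewrite -tE subterm_flat; case: subterm => //= -[x|g ts] //=.
  exact: root_unann.
elim: t => [//|g ts IH] una /=.
have -> : (fun i => flat (ts i)) = ts.
  apply: funext => i; apply: IH => p [f pf]; apply: (una (val i :: p)).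
  by exists f; rewrite subterm_App.
case: g ts una {IH} => // f ts una; case: (una [::]); by exists f.
Qed.

Lemma plain_sub t p s : flat t = t -> subterm t p = Some s -> flat s = s.
Proof. by move=> tE tp; move: (subterm_flat t p); rewrite tE tp => -[]. Qed.

Lemma plain_pos_ann t p : flat t = t -> ~ pos_ann t p.
Proof. by move/unann_flatP. Qed.

Lemma pos_ann_cat t p q s : subterm t p = Some s -> pos_ann t (p ++ q) <-> pos_ann s q.
Proof. by move=> tp; rewrite /pos_ann subterm_cat tp. Qed.

Lemma flat_replace t p u e :
  subterm t p = Some u -> flat (replace t p e) = replace (flat t) p (flat e).
Proof.
elim: p t => [|n p IH] t; first by rewrite ?cat0s subterm_nil => -[->]; rewrite ?subterm_nil ?replace_nil.
case: t => [x|g ts] // /subterm_cons[i -> tp].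
have -> : flat (replace (App g ts) (val i :: p) e) =
          unann_app (fun j : 'I_(arity g) =>
             if j == i then replace (flat (ts j)) p (flat e) else flat (ts j)).
  rewrite replace_App [LHS]/=; congr (unann_app _); apply: funext => j.
  by case: eqP => [->|//]; rewrite IH.
by case: g ts i tp => [c|f|f] ts i tp.
Qed.

Lemma plain_replace t p u e :
  flat t = t -> flat e = e -> subterm t p = Some u ->
  flat (replace t p e) = replace t p e.
Proof. by move=> tE eE tp; rewrite (flat_replace _ tp) tE eE. Qed.

Lemma subterm_flat_above p q t :
  ~~ prefix q p || (q == p) -> subterm (flat_above p t) q = subterm t q.
Proof.
elim: p q t => [|i p IH] q t; first by rewrite flat_above_nil.
case: q t => [|j q] [x|g ts] //.
rewrite prefix_cons eqseq_cons /= subterm_unann_cons /=.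
case: insubP => // k _ <-; case: eqP => //= _.
by move=> /IH ->.
Qed.

Lemma pos_ann_flat_above p q t :
  prefix q p -> q != p -> ~ pos_ann (flat_above p t) q.
Proof.
elim: p q t => [|i p IH] [|j q] [x|g ts] //.
- by move=> _ _ [f].
- by move=> _ _ [f]; rewrite subterm_nil; exact: root_unann.
- by move=> _ _ [f].
rewrite prefix_cons eqseq_cons => /andP[/eqP ->]; rewrite eqxx /= => qp nqp [f].
rewrite subterm_unann_cons /=; case: insubP => // k _ kj; rewrite kj eqxx => kf.
by apply: (IH q (ts k) qp nqp); exists f.
Qed.

Lemma vars_sub t p u : subterm t p = Some u -> vars u `<=` vars t.
Proof.
by move=> tp x [q uq]; exists (p ++ q); rewrite subterm_cat tp.
Qed.

Lemma vars_App (g : sym S) (ts : 'I_(arity g) -> term S V) x :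
  vars (App g ts) x <-> exists i, vars (ts i) x.
Proof.
split=> [[[//|n p]] /subterm_cons[i _ ip]|[i [p ip]]].
  by exists i; exists p.
by exists (val i :: p); rewrite subterm_App.
Qed.

Lemma vars_flat t : vars (flat t) = vars t.
Proof.
apply/seteqP; split=> x [p]; last by move=> tp; exists p; rewrite subterm_flat tp.
rewrite subterm_flat; case E: subterm => [[y|g ts]|] //= [].
  by move=> <-; exists p.
by case: g ts E.
Qed.

Lemma vars_finite t : finite_set (vars t).
Proof.
elim: t => [x|g ts IH].
  apply: (sub_finite_set _ (finite_set1 x)) => y [[|//]] /= [] ->; exact: erefl.
apply: (@sub_finite_set _ _ (\bigcup_(i in [set: 'I_(arity g)]) vars (ts i))).
  by move=> x /vars_App[i xi]; exists i.
by apply: bigcup_finite => // i _; apply: IH.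
Qed.

Lemma subst_ext (s1 s2 : V -> term S V) t :
  (forall x, vars t x -> s1 x = s2 x) -> subst s1 t = subst s2 t.
Proof.
elim: t => [x|g ts IH] s12 /=; first by apply: s12; exists [::].
apply: eq_App => i; apply: IH => x xi; apply: s12; apply/vars_App.
by exists i.
Qed.

Lemma subst_inj (s1 s2 : V -> term S V) t :
  subst s1 t = subst s2 t -> forall x, vars t x -> s1 x = s2 x.
Proof.
elim: t => [x|g ts IH] /=; first by move=> e y [[|//]] [] <-.
by move/App_inj/(congr1 (@^~ _)) => /= e x /vars_App[i]; apply: IH.
Qed.

Lemma subst_comp (s1 s2 : V -> term S V) t :
  subst s1 (subst s2 t) = subst (fun x => subst s1 (s2 x)) t.
Proof. by elim: t => [//|g ts IH] /=; apply: eq_App. Qed.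

Lemma subst_var t : subst Var t = t.
Proof. by elim: t => [//|g ts IH] /=; apply: eq_App. Qed.

Lemma subst_ground (s : V -> term S V) t : ground t -> subst s t = t.
Proof.
move=> gt; rewrite -[RHS]subst_var; apply: subst_ext => x.
by rewrite gt.
Qed.

Lemma subterm_subst (s : V -> term S V) t p u :
  subterm t p = Some u -> subterm (subst s t) p = Some (subst s u).
Proof.
elim: p t => [|n p IH] t; first by rewrite ?cat0s subterm_nil => -[->]; rewrite ?subterm_nil ?replace_nil.
by case: t => [x|g ts] // /subterm_cons[i -> tp]; rewrite subterm_App IH.
Qed.

Lemma replace_subst (s : V -> term S V) t p u e :
  subterm t p = Some u -> subst s (replace t p e) = replace (subst s t) p (subst s e).
Proof.
elim: p t => [|n p IH] t; first by rewrite ?cat0s subterm_nil => -[->]; rewrite ?subterm_nil ?replace_nil.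
case: t => [x|g ts] // /subterm_cons[i -> tp].
rewrite [subst s (App g ts)]/= !replace_App /=; apply: eq_App => j.
by case: eqP => [->|//]; rewrite IH.
Qed.

Lemma subterm_substP (s : V -> term S V) t p u :
  subterm (subst s t) p = Some u ->
  (exists u', [/\ subterm t p = Some u', root_sym u' <> None & u = subst s u'])
  \/ (exists p1 p2 x, [/\ p = p1 ++ p2, subterm t p1 = Some (Var x) &
                         subterm (s x) p2 = Some u]).
Proof.
elim: p t => [|n p IH] [x|g ts].
- by move=> sx; right; exists [::], [::], x.
- by move=> /= [<-]; left; exists (App g ts).
- by move=> /= up; right; exists [::], (n :: p), x.
- move=> /subterm_cons[i -> /IH[[u' [u1 u2 u3]]|[p1 [p2 [x [-> e1 e2]]]]]].
    by left; exists u'; rewrite subterm_App.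
  by right; exists (val i :: p1), p2, x; rewrite subterm_App.
Qed.

Lemma flat_subst (s : V -> term S V) t :
  flat t = t -> (forall x, vars t x -> flat (s x) = s x) ->
  flat (subst s t) = subst s t.
Proof.
move=> /unann_flatP una sp; apply/unann_flatP => p [f].
case E: subterm => [u|] //= rf.
have [[u' [e1 e2 ue]]|[p1 [p2 [x [_ e1 e2]]]]] := subterm_substP E.
  apply: (una p); exists f; rewrite e1 /=; move: rf e2; rewrite ue.
  by case: u' {e1 ue}.
have := plain_sub (sp x _) e2; have /[swap] /[apply] : vars t x by exists p1.
by move/unann_flatP/(_ [::]); apply; exists f; rewrite subterm_nil.
Qed.

Lemma plain_subst_inv (s : V -> term S V) t :
  flat (subst s t) = subst s t -> forall x, vars t x -> flat (s x) = s x.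
Proof.
move=> tE x [p tp]; apply: (plain_sub tE (p := p)).
exact: (subterm_subst s tp).
Qed.

(** With a single occurrence of [x], changing that copy of [s x] amounts to changing the
    substitution at [x]. *)
Lemma replace_linear (s : V -> term S V) t p1 p2 x e :
  linear_term t -> subterm t p1 = Some (Var x) ->
  replace (subst s t) (p1 ++ p2) e =
  subst (fun y => if y == x then replace (s x) p2 e else s y) t.
Proof.
move=> lin tp; rewrite (replace_cat _ _ (subterm_subst s tp)) /=.
move: (replace (s x) p2 e) => {}e.
elim: p1 t lin tp => [|n p IH] t lin; first by rewrite subterm_nil replace_nil => -[->] /=; rewrite eqxx.
case: t lin => [y|g ts] lin // /subterm_cons[i ni tp]; subst n.
rewrite [subst _ (App g ts)]/= replace_App /=; apply: eq_App => j.
have [ji|ji] := eqVneq j i.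
  subst j; apply: IH => // y q q' yq yq'.
  suff: val i :: q = val i :: q' by case.
  by apply: (lin y); rewrite subterm_App.
apply: subst_ext => y [q yq]; case: eqP => // yx; subst y.
suff [/val_inj ij _] : val j :: q = val i :: p by rewrite ij eqxx in ji.
by apply: (lin x); rewrite subterm_App.
Qed.

Lemma linear_flat t : linear_term t -> linear_term (flat t).
Proof.
have aux q x : subterm (flat t) q = Some (Var x) -> subterm t q = Some (Var x).
  rewrite subterm_flat; case: subterm => [[y|g ts]|] //=.
  by case: g ts.
by move=> lin x p q /aux xp /aux xq; apply: (lin x).
Qed.

Lemma fresh_renaming (infV : infinite_set [set: V]) (A : set V) (xs : seq V) :
  finite_set A -> exists rho : V -> V,
    {in xs &, injective rho} /\ forall x, x \in xs -> ~ A (rho x).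
Proof.
move=> fA; elim: xs => [|x xs [rho [inj_rho fresh]]]; first by exists id.
have [xxs|xxs] := boolP (x \in xs).
  by exists rho; split=> [y z|y]; rewrite !inE;
    do ?[case/predU1P => [->|?]]; do ?[case/predU1P => [->|?]];
    by [apply: inj_rho|apply: fresh].
have [y [_ /not_orP[nAy nxy]]] : ([set: V] `\` (A `|` [set` map rho xs])) !=set0.
  apply: infinite_setN0; apply: infinite_setD => //.
  by rewrite finite_setU; split=> //; apply: finite_seq.
exists (fun z => if z == x then y else rho z); split=> [u v|u].
  rewrite !inE; case: eqVneq => [->|ux] /=; case: eqVneq => [->|vx] //=.
  - by move=> _ vs yv; case: nxy; rewrite yv /=; apply/mapP; exists v.
  - by move=> us _ yv; case: nxy; rewrite -yv /=; apply/mapP; exists u.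
  - exact: inj_rho.
by rewrite inE; case: eqVneq => //= _; apply: fresh.
Qed.

(** Overlaps are defined by unification after renaming apart, whereas the proof meets instances that
    coincide. Since [V] is infinite, [l] can be renamed away from [l'], and the two matchers are
    then glued into one unifier. *)
Lemma unify_match (infV : infinite_set [set: V]) (l l' u : term S V)
    (s s' : V -> term S V) p :
  subterm l' p = Some u -> subst s l = subst s' u -> unifies_apart l l' u.
Proof.
move=> l'p e.
have /finite_seqP[xs lxs] := vars_finite l.
have [rho [inj_rho fresh]] := fresh_renaming infV xs (vars_finite l').
have inl x : vars l x -> x \in xs by rewrite lxs.
exists rho; split.
- by move=> x y /set_mem xl /set_mem yl; apply: inj_rho; apply: inl.
- by apply/seteqP; split=> // _ [[x xl <-]] /fresh; apply; apply: inl.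
(* The renaming is inverted on its image by choice; the default value [y] is met only outside that
   image. *)
- pose rinv (y : V) := xget y [set x | vars l x /\ rho x = y].
  exists (fun y => if pselect (exists2 x, vars l x & rho x = y)
                   then s (rinv y) else s' y).
  rewrite subst_comp /= (_ : subst _ l = subst s l).
    rewrite e; apply: subst_ext => x xu; case: pselect => // -[y yl yx]; subst x.
    by case: (fresh y (inl _ yl)); apply: (vars_sub l'p).
  apply: subst_ext => x xl; case: pselect => [ex|nex]; last by case: nex; exists x.
  rewrite /rinv; case: xgetP => [y _ [yl yx]|/(_ x)]; last by case.
  by congr s; apply: inj_rho => //; apply: inl.
Qed.

End TermTheory.

(** * Transition systems and chain trees *)

Section Systems.
Context {R : realType}.

(** * Leaf probability within bounded depth *)

Section Mass.
Context {Q : eqType} (succ : Q -> seq (R * Q)).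

Fixpoint mass (n : nat) (x : Q) : R :=
  if nilp (succ x) then 1
  else if n is m.+1 then \sum_(y <- succ x) y.1 * mass m y.2 else 0.

(** The step relation from R-nodes, read backwards. Accessibility of all states excludes infinite
    paths consisting of R-nodes only, which is condition (6) applied to every tail of a path. *)
Definition Rsucc (isP : Q -> bool) (y x : Q) : Prop :=
  ~~ isP x /\ exists p, (p, y) \in succ x.

Hypothesis succ_ge0 : forall x y, y \in succ x -> 0 <= y.1.

Lemma mass_ge0 n x : 0 <= mass n x.
Proof.
elim: n x => [|n IH] x /=; case: ifP => // _.
by rewrite big_seq; apply: sumr_ge0 => y yx; rewrite mulr_ge0 ?(succ_ge0 yx).
Qed.

Lemma mass_leaf n x : succ x = [::] -> mass n x = 1.
Proof. by case: n => [|n] /= ->. Qed.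

Lemma massS n x : succ x <> [::] ->
  mass n.+1 x = \sum_(y <- succ x) y.1 * mass n y.2.
Proof. by move=> /=; case: (succ x). Qed.

Lemma mass_mono m n x : (m <= n)%N -> mass m x <= mass n x.
Proof.
elim: m n x => [|m IH] n x mn.
  by case: n mn => [|n] _ //; rewrite /=; case: ifP => // E; have := mass_ge0 n.+1 x; rewrite /= E.
case: n mn => // n mn /=; case: ifP => // _.
rewrite big_seq [leRHS]big_seq; apply: ler_sum => y yx.
by rewrite ler_wpM2l ?(succ_ge0 yx) ?IH.
Qed.

Lemma mass_le1 n x : (forall y, succ y <> [::] -> \sum_(z <- succ y) z.1 = 1) ->
  mass n x <= 1.
Proof.
move=> sum1; elim: n x => [|n IH] x /=; case: ifP => // xn.
rewrite -[leRHS](sum1 x); last by move=> x0; rewrite x0 in xn.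
rewrite big_seq [leRHS]big_seq; apply: ler_sum => y yx.
by rewrite ler_piMr ?(succ_ge0 yx).
Qed.

End Mass.

Lemma uniq_flatten_map (I J : eqType) (s : seq I) (f : I -> seq J) :
  uniq s -> (forall x, x \in s -> uniq (f x)) ->
  (forall x y u, x \in s -> y \in s -> u \in f x -> u \in f y -> x = y) ->
  uniq (flatten (map f s)).
Proof.
elim: s => [//|x s IH] /= /andP[xs us] uf dis.
rewrite cat_uniq uf ?mem_head //= IH //.
- rewrite andbT; apply/hasPn => u /flatten_mapP[y ys uy]; apply/negP => ux.
  by move: xs; rewrite (dis x y u) ?ys ?mem_head // inE ys orbT.
- by move=> y ys; apply: uf; rewrite inE ys orbT.
- by move=> y z u ys zs; apply: dis; rewrite inE (ys, zs) orbT.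
Qed.

End Systems.

Section Trees.
Context {R : realType} {S : signature} {V : choiceType}.
Implicit Types (P : {fset adp R S V}) (s t : term S V).

(** * A chain tree as a transition system *)

Section OneTree.
Context (P : {fset adp R S V}) (T : chain_tree P).
Implicit Types (v w u : node T) (q : seq (node T)).

Definition kids v : seq (node T) := fset_set (children (edge T) v).

Definition tsucc v : seq (R * node T) := [seq (prob w / prob v, w) | w <- kids v].

Lemma mem_kids v w : (w \in kids v) = edge T v w.
Proof. by rewrite in_fset_set ?mem_setE //; exact: ct_fin. Qed.

Lemma prob_gt0 v : 0 < prob v.
Proof. by have /andP[] := ct_prob v. Qed.

Fixpoint lvs (n : nat) v : seq (node T) :=
  if nilp (tsucc v) then [:: v]
  else if n is m.+1 then flatten [seq lvs m w | w <- kids v] else [::].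

Lemma sum_lvs n v : \sum_(u <- lvs n v) prob u = prob v * mass tsucc n v.
Proof.
elim: n v => [|n IH] v /=; case: ifP => _; rewrite ?big_seq1 ?mulr1 //.
  by rewrite big_nil mulr0.
rewrite big_flatten big_map mulr_sumr big_map; apply: eq_bigr => w _.
by rewrite IH mulrA mulrCA mulrA mulfK // gt_eqF // prob_gt0.
Qed.

Lemma leafE v : leaves T v <-> tsucc v = [::].
Proof.
split=> [leaf|no [w vw]].
  rewrite /tsucc; case E : (kids v) => [//|w s]; case: leaf; exists w.
  by rewrite /children /= -mem_kids E mem_head.
have : w \in kids v by rewrite mem_kids.
by move: no; rewrite /tsucc; case: (kids v).
Qed.

Lemma lvsP n v u : u \in lvs n v ->
  leaves T u /\ exists q, [/\ path (edge T) v q, last v q = u & (size q <= n)%N].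
Proof.
elim: n v => [|n IH] v /=; case: ifP => // vn.
- rewrite inE => /eqP ->; split; first by apply/leafE/nilP; rewrite vn.
  by exists [::].
- rewrite inE => /eqP ->; split; first by apply/leafE/nilP; rewrite vn.
  by exists [::].
- case/flatten_mapP => w; rewrite mem_kids => vw /IH[lu [q [pq lq sq]]]; split=> //.
  by exists (w :: q); rewrite /= vw.
Qed.

Lemma lvs_complete n v q : path (edge T) v q -> leaves T (last v q) ->
  (size q <= n)%N -> last v q \in lvs n v.
Proof.
elim: n v q => [|n IH] v [|w q] //=.
- by move=> _ /leafE ->; rewrite inE.
- by move=> _ /leafE ->; rewrite inE.
move=> /andP[vw pq] lq sq; case: ifP => [/nilP/leafE []|_]; first by exists w.
by apply/flatten_mapP; exists w; rewrite ?mem_kids //; apply: IH.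
Qed.

Lemma path_to v : exists2 q, path (edge T) (troot T) q & last (troot T) q = v.
Proof. by have [q [[]]] := ct_tree v; exists q. Qed.

Lemma path_uniq q q' : path (edge T) (troot T) q -> path (edge T) (troot T) q' ->
  last (troot T) q = last (troot T) q' -> q = q'.
Proof.
move=> pq pq' e; have [q0 [_ q0P]] := ct_tree (last (troot T) q).
by rewrite -(q0P q) // -(q0P q').
Qed.

(** A leaf reached through two distinct children would be reached by two distinct paths from the
    root. *)
Lemma uniq_lvs n v : uniq (lvs n v).
Proof.
elim: n v => [|n IH] v /=; case: ifP => // _.
apply: uniq_flatten_map => [|//|w w' u]; first exact: fset_uniq.
rewrite !mem_kids => vw vw' /lvsP[_ [q [pq lq _]]] /lvsP[_ [q' [pq' lq' _]]].
have [q0 pq0 lq0] := path_to v.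
suff /(congr1 (drop (size q0))) : q0 ++ w :: q = q0 ++ w' :: q'.
  by rewrite !drop_size_cat // => -[].
by apply: path_uniq; rewrite ?cat_path ?last_cat ?lq0 /= ?pq0 ?vw ?vw' ?pq ?pq' ?lq ?lq'.
Qed.

Lemma mass_le_leaf_mass n : ((mass tsucc n (troot T))%:E <= leaf_mass T)%E.
Proof.
apply: esum_ge; exists [set` lvs n (troot T)].
  by split; [exact: finite_seq|move=> u /lvsP[]].
by rewrite -fsbig_seq ?uniq_lvs // sumEFin sum_lvs ct_prob_root mul1r.
Qed.

(** Every finite set of leaves lies within some depth [N], so its weight is part of [mass] at depth
    [N]; the infinite sum is the supremum over such finite sets. *)
Lemma leaf_mass_le (b : R) : (forall n, mass tsucc n (troot T) <= b) ->
  (leaf_mass T <= b%:E)%E.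
Proof.
move=> mb; apply: ge_ereal_sup => _ [A [fA Aleaf] <-].
have [N AN] : exists N, A `<=` [set` lvs N (troot T)].
  have /finite_seqP[s sA] := fA.
  have {}Aleaf u : u \in s -> leaves T u by move=> us; apply: Aleaf; rewrite sA.
  suff [N HN] : exists N, forall u, u \in s -> u \in lvs N (troot T).
    by exists N => u; rewrite sA /=; exact: HN.
  elim: s {sA} Aleaf => [|u s IH] leaf; first by exists 0%N.
  have [|N HN] := IH; first by move=> w ws; apply: leaf; rewrite inE ws orbT.
  have [q pq lq] := path_to u.
  exists (maxn (size q) N) => w; rewrite inE => /predU1P[->|/HN/lvsP[lw [r [pr lr sr]]]].
    by rewrite -lq; apply: lvs_complete; rewrite ?leq_maxl // lq; apply: leaf; rewrite mem_head.
  by rewrite -lr; apply: lvs_complete; rewrite ?lr // leq_max sr orbT.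
rewrite fsbig_finite //=; apply: (@le_trans _ _ (\sum_(u <- lvs N (troot T)) prob u)%:E).
  rewrite sumEFin lee_fin.
  have pe : perm_eq (fset_set A) [seq u <- lvs N (troot T) | u \in fset_set A].
    apply: uniq_perm; rewrite ?fset_uniq ?filter_uniq ?uniq_lvs // => u.
    rewrite mem_filter; case: (boolP (u \in fset_set A)) => //=.
    by rewrite in_fset_set // inE => /AN ->.
  rewrite (perm_big _ pe) big_filter big_mkcond; apply: ler_sum => u _.
  by case: ifP => // _; rewrite ltW // prob_gt0.
by rewrite sum_lvs ct_prob_root mul1r lee_fin.
Qed.

End OneTree.

Lemma mset_map_mem (A B : choiceType) (f : A -> B) (mu : {mset A}) (y : B) :
  y \in mset_map f mu -> exists2 x, x \in mu & y = f x.
Proof. by rewrite (perm_mem (perm_eq_seq_mset _)) => /mapP. Qed.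

Lemma sum_mset_map (A B : choiceType) (f : A -> B) (mu : {mset A}) (F : B -> R) :
  \sum_(y <- mset_map f mu) F y = \sum_(x <- mu) F (f x).
Proof. by rewrite (perm_big _ (perm_eq_seq_mset _)) big_map. Qed.

Lemma istep_multidist P s pi mu : adp_problem P -> istep P s pi mu -> multidist mu.
Proof.
move=> adpP [a [sg [aP _ [_ _ ->]]]]; have [_ _ [rng sum1] _] := adpP a aP.
split; last by rewrite sum_mset_map.
by move=> y /mset_map_mem[x /rng xr ->].
Qed.

(** Abstract form of a chain tree, in which states may be revisited. [St b s mu] says which
    successor labels are admissible for a label [s] at a P-node or an R-node, so that the same
    notion serves [P], [P''] and the restricted steps in between. *)
Definition system (St : bool -> term S V -> seq (R * term S V) -> Prop)
    (Q : eqType) (lab : Q -> term S V) (isP : Q -> bool) (succ : Q -> seq (R * Q)) :=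
  [/\ forall x, succ x <> [::] -> St (isP x) (lab x) [seq (y.1, lab y.2) | y <- succ x],
      forall x y, y \in succ x -> 0 < y.1 <= 1
    & forall x, Acc (Rsucc succ isP) x].

Definition tree_step P (b : bool) s (mu : seq (R * term S V)) : Prop :=
  exists2 pi, b <-> pos_ann s pi & istep P s pi (seq_mset mu).

Lemma Acc_chain (Q : Type) (r : Q -> Q -> Prop) (w : nat -> Q) :
  (forall n, r (w n.+1) (w n)) -> ~ Acc r (w 0%N).
Proof.
move=> rw; have [x xE] : exists x, w 0%N = x by exists (w 0%N).
rewrite xE => acc; suff H : forall n, w n = x -> False by exact: H xE.
by elim: acc {xE} => y _ IH n wn; apply: (IH (w n.+1) _ n.+1) => //; rewrite -wn.
Qed.

Lemma not_Acc_chain (Q : Type) (r : Q -> Q -> Prop) (x : Q) :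
  ~ Acc r x -> exists w : nat -> Q, forall n, r (w n.+1) (w n).
Proof.
move=> nacc; pose Q' := {y : Q | ~ Acc r y}.
have next (y : Q') : exists z : Q', r (sval z) (sval y).
  apply: contrapT => no; apply: (svalP y); constructor => z rzy.
  by apply: contrapT => nz; apply: no; exists (exist _ z nz).
have [f fP] := choice next.
by exists (fun n => sval (iter n f (exist _ x nacc))) => n; apply: fP.
Qed.

Lemma tree_system P (T : chain_tree P) : adp_problem P ->
  exists2 isP : node T -> bool, system (tree_step P) (@label _ _ _ _ T) isP (@tsucc P T)
    & forall v, tsucc (T := T) v <> [::] -> \sum_(y <- tsucc (T := T) v) y.1 = 1.
Proof.
move=> adpP.
pose isP v := `[< @nodeP _ _ _ _ T v >].
have step (v : node T) : tsucc v <> [::] ->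
    tree_step P (isP v) (label v) [seq (y.1, label y.2) | y <- tsucc v].
  move=> vn; have inn : inner (edge T) v.
    by apply: contrapT => leaf; apply: vn; apply/leafE.
  have e : children_mset (edge T) prob (@label _ _ _ _ T) v =
           seq_mset [seq (y.1, label y.2) | y <- tsucc v].
    by rewrite /children_mset /tsucc -map_comp.
  rewrite /isP; case: asboolP => [vP|vR].
    by have [pi pia st] := ct_stepP vP; exists pi; rewrite -?e.
  by have [pi pia st] := ct_stepR (conj inn vR); exists pi; rewrite -?e.
have md (v : node T) : tsucc v <> [::] ->
    multidist (seq_mset [seq (y.1, label y.2) | y <- tsucc v]).
  by move/step => [pi _]; exact: istep_multidist.
exists isP; last first.
  move=> v /md[_]; by rewrite (perm_big _ (perm_eq_seq_mset _)) big_map.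
split; first exact: step.
- move=> v y yv; have [|rng _] := md v; first by case: (tsucc v) yv.
  apply: (rng (y.1, label y.2)); rewrite (perm_mem (perm_eq_seq_mset _)).
  by apply/mapP; exists y.
(* A node that is not accessible starts an infinite path of R-nodes, which condition (6)
   excludes. *)
- move=> v; apply: contrapT => nacc; have [w wP] := not_Acc_chain nacc.
  have ew n : edge T (w n) (w n.+1).
    by have [_ [p /mapP[u]]] := wP n; rewrite mem_kids => uw [_ ->].
  apply: (ct_inf ew); rewrite (_ : [set n | _] = set0) //.
  by apply/seteqP; split=> // n /= wnP; have [] := wP n; rewrite /isP asboolT.
Qed.

(** * Unfolding a system into a chain tree *)

Section Realise.
Context (P : {fset adp R S V}) (Q : eqType) (lab : Q -> term S V) (isP : Q -> bool)
  (succ : Q -> seq (R * Q)) (sys : system (tree_step P) lab isP succ) (x0 : Q).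

Fixpoint state (s : seq nat) : Q :=
  if s is i :: s' then (nth (0, x0) (succ (state s')) i).2 else x0.

Fixpoint valid (s : seq nat) : bool :=
  if s is i :: s' then valid s' && (i < size (succ (state s')))%N else true.

Fixpoint pr (s : seq nat) : R :=
  if s is i :: s' then (nth (0, x0) (succ (state s')) i).1 * pr s' else 1.

(* Nodes are paths from the root, stored in reverse. *)
Definition rnode : choiceType := {s : seq nat | valid s}.

Definition redge (u v : rnode) : bool := if val v is _ :: s then s == val u else false.

Definition rroot : rnode := exist _ [::] isT.

Definition rkids (u : rnode) : seq rnode :=
  pmap insub [seq i :: val u | i <- iota 0 (size (succ (state (val u))))].

Lemma mem_rkids u v : (v \in rkids u) = redge u v.
Proof.
rewrite mem_pmap_sub /redge; case: v => [[|i s] /= vs].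
  by apply/mapP => -[].
apply/mapP/eqP => [[j _ [_ ->]]|su] //; exists i; last by rewrite su.
by rewrite mem_iota /= -su; case/andP: vs.
Qed.

Lemma rkids_val u :
  map val (rkids u) = [seq i :: val u | i <- iota 0 (size (succ (state (val u))))].
Proof.
rewrite pmap_filter; last exact: insubK.
apply/all_filterP/allP => _ /mapP[i + ->]; rewrite mem_iota /= => iu.
by rewrite isSome_insub /= iu (valP u).
Qed.

Lemma rchildren u : children redge u = [set` rkids u].
Proof. by apply/seteqP; split=> v /=; rewrite mem_rkids. Qed.

Lemma rfin u : finite_set (children redge u).
Proof. by rewrite rchildren; exact: finite_seq. Qed.

Lemma rkids_perm u : perm_eq (fset_set (children redge u)) (rkids u).
Proof.
apply: uniq_perm; rewrite ?fset_uniq //.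
  apply: pmap_uniq; first exact: insubK.
  by rewrite map_inj_uniq ?iota_uniq // => i j [].
by move=> v; rewrite (in_fset_set (rfin u)) rchildren mem_setE.
Qed.

Lemma pr_rng (s : seq nat) : valid s -> 0 < pr s <= 1.
Proof.
have [_ rng _] := sys.
elim: s => [|i s IH] /=; first by rewrite ltr01 lexx.
case/andP=> /IH/andP[s0 s1] /(mem_nth (0, x0)) /rng /andP[i0 i1].
by rewrite mulr_gt0 ?mulr_ile1 // ltW.
Qed.

Lemma rsuccE (A : Type) (f : R -> Q -> A) u :
  [seq f (pr (val w) / pr (val u)) (state (val w)) | w <- rkids u] =
  [seq f y.1 y.2 | y <- succ (state (val u))].
Proof.
rewrite (map_comp (fun s : seq nat => f (pr s / pr (val u)) (state s)) val) rkids_val -map_comp.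
rewrite -[in RHS](mkseq_nth (0, x0) (succ (state (val u)))) /mkseq -map_comp.
apply: eq_map => i /=; rewrite mulfK // gt_eqF //.
by have /andP[] := pr_rng (valP u).
Qed.

Lemma rinnerE u : inner redge u <-> succ (state (val u)) <> [::].
Proof.
have := rsuccE pair u; rewrite /inner /= rchildren.
case: (rkids u) => [|w s]; case: (succ _) => [|y s'] //= _; split=> //.
- by case=> w.
- by move=> _; exists w; rewrite /= mem_head.
Qed.

Lemma rchildren_mset u :
  children_mset redge (fun w => pr (val w)) (fun w => lab (state (val w))) u =
  seq_mset [seq (y.1, lab y.2) | y <- succ (state (val u))].
Proof.
rewrite -(rsuccE (fun p y => (p, lab y))) /children_mset.
by apply/eq_seq_msetP; apply: perm_map; exact: rkids_perm.
Qed.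

Lemma rtree v : exists! q, path redge rroot q /\ last rroot q = v.
Proof.
have ex : forall (s : seq nat) (hs : valid s), exists q, path redge rroot q /\ last rroot q = exist _ s hs.
  elim=> [|i s IH] hs; first by exists [::]; split=> //; apply: val_inj.
  have /andP[hs' _] := hs; have [q [pq lq]] := IH hs'.
  exists (rcons q (exist (fun r : seq nat => is_true (valid r)) (i :: s) hs)); rewrite rcons_path last_rcons pq lq; split=> //.
  by rewrite /redge /= eqxx.
case: v => s hs; have [q [pq lq]] := ex s hs; exists q; split=> // q' [].
elim: s hs q q' pq lq {ex} => [|i s IH] hs q q'.
  have no r : ~ path redge rroot r \/ last rroot r <> exist _ [::] hs \/ r = [::].
    case/lastP: r => [|r z]; first by right; right.
    have [zE|] := pselect (z = exist _ [::] hs); last by rewrite last_rcons; right; left.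
    by left; rewrite rcons_path zE => /andP[].
  case: (no q) => [//|[//|->]]; case: (no q') => [//|[//|->]] //.
case/lastP: q => [|q z]; first by move=> _ [].
case/lastP: q' => [|q' z']; first by move=> _ _ _ [].
rewrite !rcons_path !last_rcons => /andP[pq ez] zE /andP[pq' ez'] zE'; subst z z'.
have /andP[hs' _] := hs.
have lE r : redge (last rroot r) (exist _ (i :: s) hs) -> last rroot r = exist _ s hs'.
  by rewrite /redge /= => /eqP e; apply: val_inj.
by have -> : q = q' := IH hs' q q' pq (lE _ ez) pq' (lE _ ez').
Qed.

Lemma realise : exists T : chain_tree P,
  forall n, mass (@tsucc P T) n (troot T) = mass succ n x0.
Proof.
have [step rng acc] := sys.
pose nP := [set u : rnode | inner redge u /\ isP (state (val u))].
have stepP (v : rnode) : nP v ->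
    exists2 pi, pos_ann (lab (state (val v))) pi & istep P (lab (state (val v))) pi
      (children_mset redge (fun w => pr (val w)) (fun w => lab (state (val w))) v).
  move=> [/rinnerE vi vP]; have [pi pia st] := step _ vi.
  by exists pi; [apply/pia|rewrite rchildren_mset].
have stepR (v : rnode) : (inner redge `\` nP) v ->
    exists2 pi, ~ pos_ann (lab (state (val v))) pi & istep P (lab (state (val v))) pi
      (children_mset redge (fun w => pr (val w)) (fun w => lab (state (val w))) v).
  move=> [vi vP]; have /rinnerE vi' := vi; have [pi pia st] := step _ vi'.
  by exists pi; [move/pia => vp; apply: vP|rewrite rchildren_mset].
have infP (w : nat -> rnode) : (forall n, redge (w n) (w n.+1)) ->
    infinite_set [set n | nP (w n)].
  move=> ew /finite_seqP[ns nsE].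
  (* All P-nodes of the path would come before [N], so the tail from [N] on would be an infinite
     path of R-nodes. *)
  pose N := (\max_(i <- ns) i).+1.
  have noP n : ~~ isP (state (val (w (N + n)%N))).
    apply/negP => wP; suff : (N + n)%N \in ns.
      move=> /(@leq_bigmax_seq _ ns xpredT id) /(_ isT).
      by rewrite leqNgt /N addSn ltnS leq_addr.
    have : [set n | nP (w n)] (N + n)%N.
      by split; [exists (w (N + n).+1); exact: ew|exact: wP].
    by rewrite nsE.
  apply: (@Acc_chain _ (Rsucc succ isP) (fun n => state (val (w (N + n)%N)))) => //.
  move=> n; split=> //; have := ew (N + n)%N; rewrite addnS /redge.
  have := valP (w (N + n).+1); case: (val _) => [//|i s] /= /andP[_ si] /eqP sE.
  rewrite -sE; exists (nth (0, x0) (succ (state s)) i).1.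
  by rewrite -surjective_pairing mem_nth.
pose T := @ChainTree R S V P rnode redge rroot (fun w => pr (val w))
  (fun w => lab (state (val w))) nP rtree rfin (fun v => pr_rng (valP v)) erefl
  (fun v (h : nP v) => h.1) stepP stepR infP.
exists T => n; suff H : forall u : rnode, mass (@tsucc P T) n u = mass succ n (state (val u)).
  exact: (H rroot).
have szE (u : rnode) : nilp (@tsucc P T u) = nilp (succ (state (val u))).
  rewrite /tsucc /nilp size_map /kids /= (perm_size (rkids_perm u)).
  by have /(congr1 size) := rsuccE pair u; rewrite !size_map => ->.
elim: n => [|n IH] u /=; rewrite szE //; case: ifP => // _.
rewrite /tsucc big_map (perm_big _ (rkids_perm u)) /=.
under eq_bigr do rewrite IH.
have := rsuccE (fun p y => p * mass succ n y) u.
by move=> /(congr1 (fun l => \sum_(z <- l) z)); rewrite !big_map.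
Qed.

End Realise.

End Trees.

(** * Simulations with stuttering *)

Section Simulation.
Context {R : realType} {S : signature} {V : choiceType}.
Implicit Types (s t : term S V).
Context (St : bool -> term S V -> seq (R * term S V) -> Prop).

(** The kind of each step is left open: additional P-nodes do no harm to condition (6). *)
Fixpoint dets (k : nat) s t : Prop :=
  if k is k'.+1 then exists2 u, (exists b, St b s [:: (1, u)]) & dets k' u t
  else s = t.

Lemma dets_cat k k' s t u : dets k s t -> dets k' t u -> dets (k + k') s u.
Proof.
elim: k s => [|k IH] s /=; first by move=> ->.
by move=> [v sv vt] tu; exists v => //; apply: IH.
Qed.

Context (Q : eqType) (isP : Q -> bool) (succ : Q -> seq (R * Q)).
Hypothesis succ_rng : forall x y, y \in succ x -> 0 < y.1 <= 1.
Hypothesis succ_acc : forall x, Acc (Rsucc succ isP) x.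

Context (Sim : Q -> term S V -> Prop).

(** [zs] couples the successors of [x] with reducts of [s] of equal probability. An R-node may be
    matched by a P-node but not conversely, hence the mere implication from [isP x] to [b]. *)
Definition matches (x : Q) (b : bool) s (zs : seq ((R * Q) * term S V)) : Prop :=
  [/\ map fst zs = succ x, St b s [seq (z.1.1, z.2) | z <- zs],
      isP x -> b & forall z, z \in zs -> Sim z.1.2 z.2].

(** The second alternative absorbs an R-step of probability 1: the state moves on, while the term
    has made only its [k] preparatory steps. *)
Hypothesis Sim_step : forall x t, Sim x t -> succ x <> [::] ->
  exists k s, dets k t s /\
    ((exists b zs, matches x b s zs)
     \/ (exists y, [/\ succ x = [:: (1, y)], ~~ isP x & Sim y s])).

Inductive stutter : Q -> Q -> Prop :=
  | stutter_refl x : stutter x x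
  | stutter_step x y z : succ x = [:: (1, y)] -> ~~ isP x -> stutter y z -> stutter x z.

Definition ready x s := succ x = [::] \/ exists b zs, matches x b s zs.

(** Invariant of the states below: the number is the count of preparatory steps still to be made, so
    that such steps become transitions of their own. *)
Definition good (z : Q * nat * term S V) : bool :=
  `[< exists2 s, dets z.1.2 z.2 s & ready z.1.1 s >].

(** Absorbed steps are R-steps, so by accessibility only finitely many occur before a leaf or a
    matching step is met. *)
Lemma settle x t : Sim x t -> exists x' k, stutter x x' /\ good (x', k, t).
Proof.
elim: (succ_acc x) t => {}x _ IH t xt.
have [x0|x0] := pselect (succ x = [::]).
  by exists x, 0%N; split; [exact: stutter_refl|apply/asboolP; exists t => //; left].
have [k [s [ts [[b [zs m]]|[y [xy xP ys]]]]]] := Sim_step xt x0.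
  exists x, k; split; first exact: stutter_refl.
  by apply/asboolP; exists s => //; right; exists b, zs.
have [|x' [k' [yx' /asboolP[s' ss' rs']]]] := IH y _ s ys.
  by split=> //; exists 1; rewrite xy mem_head.
exists x', (k + k')%N; split; first exact: stutter_step xy xP yx'.
by apply/asboolP; exists s' => //; apply: dets_cat ts ss'.
Qed.

Definition sstate := {z : Q * nat * term S V | good z}.

(** A relation rather than a function, since the simulation hypothesis only provides existence; the
    successors are fixed by choice in [simulation]. *)
Definition sstep (w : sstate) (bl : bool * seq (R * sstate)) : Prop :=
  let: (b, l) := bl in let: (x, k, s) := val w in
  [/\ l <> [::] -> St b s [seq (y.1, (val y.2).2) | y <- l],
      forall y, y \in l -> 0 < y.1 <= 1
    & [\/ [/\ k = 0%N, succ x = [::] & l = [::]],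
          exists k' y, [/\ k = k'.+1, l = [:: (1, y)] & (val y).1 = (x, k')]
        | exists zs : seq ((R * Q) * sstate),
          [/\ succ x <> [::], k = 0%N, isP x -> b, map fst zs = succ x
            & l = [seq (z.1.1, z.2) | z <- zs]
              /\ forall z, z \in zs -> stutter z.1.2 (val z.2).1.1]]].

Lemma sstep_ex w : exists bl, sstep w bl.
Proof.
case: w => -[[x [|k]] s] /= gs; have /asboolP[s' ss' rs'] := gs; last first.
  have [u [b su] us'] := ss'.
  have gu : good (x, k, u) by apply/asboolP; exists s'.
  exists (b, [:: (1, exist (fun z => is_true (good z)) (x, k, u) gu)]).
  split=> [_ //|y|]; first by rewrite inE => /eqP -> /=; rewrite ltr01 lexx.
  by constructor 2; exists k, (exist (fun z => is_true (good z)) (x, k, u) gu).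
rewrite /= in ss'; subst s'; case: rs' => [x0|[b [zs [zsx st xb zsim]]]].
  by exists (false, [::]); split=> //; constructor 1.
have [x0|x0] := pselect (succ x = [::]).
  by exists (false, [::]); split=> //; constructor 1.
have [f fP] : exists f : (R * Q) * term S V -> sstate, forall z, z \in zs ->
    stutter z.1.2 (val (f z)).1.1 /\ (val (f z)).2 = z.2.
  pose sst (z : (R * Q) * term S V) (w : sstate) :=
    z \in zs -> stutter z.1.2 (val w).1.1 /\ (val w).2 = z.2.
  suff /choice[f fP] : forall z, exists w, sst z w by exists f.
  move=> z; have [zzs|/negP nzs] := boolP (z \in zs); last first.
    by exists (exist (fun z => is_true (good z)) _ gs).
  have [x' [k [zx' gk]]] := settle (zsim z zzs).
  by exists (exist (fun z => is_true (good z)) _ gk).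
pose zs' := [seq (z.1, f z) | z <- zs].
have zs'x : map fst zs' = succ x by rewrite -zsx -map_comp.
exists (b, [seq (z.1.1, z.2) | z <- zs']); split.
- move=> _; rewrite -!map_comp (_ : map _ _ = [seq (z.1.1, z.2) | z <- zs]) //.
  by apply/eq_in_map => z /fP[_ e] /=; rewrite e.
- move=> _ /mapP[z zz -> /=]; apply: (@succ_rng x z.1).
  by rewrite -zs'x; apply: map_f.
- constructor 3; exists zs'; split=> //; split=> // _ /mapP[z zz ->] /=.
  by have [] := fP z zz.
Qed.

(** An absorbed step has probability 1 and therefore only shifts the depth. *)
Lemma stutter_mass x y : stutter x y -> exists j, forall m, mass succ m y <= mass succ (m + j) x.
Proof.
elim=> {x y} [x|x y z xy _ _ [j jP]]; first by exists 0%N => m; rewrite addn0.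
exists j.+1 => m; rewrite addnS massS ?xy //.
by rewrite big_seq1 mul1r; exact: jP.
Qed.

Lemma simulation x t : Sim x t ->
  exists (Q' : eqType) (lab' : Q' -> term S V) (isP' : Q' -> bool)
         (succ' : Q' -> seq (R * Q')) (x' : Q'),
    system St lab' isP' succ' /\
    forall b, (forall n, mass succ n x <= b) -> forall n, mass succ' n x' <= b.
Proof.
move=> xt; have [x' [k [xx' gx']]] := settle xt.
have [f fP] := choice sstep_ex.
pose succ' w := (f w).2; pose isP' w := (f w).1.
have ge0 x1 y : y \in succ x1 -> 0 <= y.1 by move/succ_rng/andP => [/ltW].
exists sstate, (fun w => (val w).2), isP', succ',
  (exist (fun z => is_true (good z)) _ gx'); split; first split.
- move=> w; rewrite /succ' /isP'; have := fP w.
  by case: (f w) => b l; case: w => -[[y k'] s] gy [].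
- move=> w; rewrite /succ'; have := fP w.
  by case: (f w) => b l; case: w => -[[y k'] s] gy [].
- move=> w; have [y yE] : exists y, y = (val w).1.1 by exists (val w).1.1.
  (* A matched step lands in a state that is reached from a genuine successor only by stuttering.
     The induction therefore runs over states [y0] that stutter to [y], and below that over the
     remaining preparatory steps. *)
  suff H : forall y0, stutter y0 y -> Acc (Rsucc succ' isP') w by exact: (H y (stutter_refl y)).
  move=> y0; elim: (succ_acc y0) w y yE => {}y0 _ IH w y yE y0y.
  case: y0y IH yE => [y1 IH yE|y1 y2 y3 e nP st IH yE]; last first.
    by apply: (IH y2 _ w y3 yE st); split=> //; exists 1; rewrite e mem_head.
  have [kw kwE] : exists kw, kw = (val w).1.2 by exists (val w).1.2.
  elim: kw w yE kwE => [|kw IHk] w yE kwE;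
    (constructor=> w' [nP [p pw']]; have := fP w; move: nP pw';
     rewrite /isP' /succ'; case: (f w) => b l /=;
     case: w yE kwE => -[[y2 k1] s1] g1 /= ? ? nb pl; subst y2 k1).
  + case=> _ _ [[_ _ l0]|[k' [z []]]//|[zs [y_n0 _ yb zsy [lE stt]]]].
      by rewrite l0 in pl.
    move: pl; rewrite lE => /mapP[z zz [pE w'E]].
    apply: (IH z.1.2) (stt z zz); last by rewrite w'E.
    split; first by apply: contra nb.
    by exists z.1.1; rewrite -surjective_pairing -zsy map_f.
  + case=> _ _ [[]//|[k' [z [kE lE zE]]]|[zs []]//].
    move: pl; rewrite lE inE => /eqP[_ ->].
    by apply: IHk; rewrite zE; case: kE.
(* The depth [m] depends on [w], because absorbed steps cost depth in [succ] but none in [succ']. *)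
- move=> b mb n; suff H : forall w, exists m, mass succ' n w <= mass succ m (val w).1.1.
    have [m /le_trans] := H (exist (fun z => is_true (good z)) _ gx'); apply.
    by have [j /(_ m)/le_trans] := stutter_mass xx'; apply.
  elim: n => [|n IH] w.
    exists 0%N; rewrite /=; have := fP w; rewrite /succ'; case: (f w) => b' l /=.
    case: w => -[[y k'] s] gy /=.
    case=> _ _ [[_ -> ->]|[k1 [z [_ -> _]]]|[zs [yn _ _ zsy [-> _]]]] //.
      by case: ifP.
    by rewrite /nilp size_map -(size_map fst) zsy; case: ifP.
  have := fP w; have := erefl (succ' w); rewrite {2}/succ'; case: (f w) => b' l; rewrite [(_, _).2]/=.
  case: w => -[[y k'] s] gy sl; rewrite [(\val _).1.1]/=.
  case=> _ _ [[_ y0 l0]|[k1 [z [_ lE zE]]]|[zs [yn _ _ zsy [lE stt]]]].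
  + by exists 0%N; rewrite !mass_leaf ?sl ?l0.
  + have [m mP] := IH z; exists m.
    by rewrite massS ?sl ?lE // big_seq1 mul1r; rewrite zE in mP.
  (* A common depth for the finitely many successors, by monotonicity of [mass]. *)
  + have [M MP] : exists M, forall z, z \in zs -> mass succ' n z.2 <= mass succ M z.1.2.
      elim: zs stt {zsy lE} => [|z zs IHz] stt; first by exists 0%N.
      have [|M MP] := IHz; first by move=> u uz; apply: stt; rewrite inE uz orbT.
      have [m mP] := IH z.2; have [j jP] := stutter_mass (stt z (mem_head _ _)).
      exists (maxn (m + j) M) => u; rewrite inE => /predU1P[->|/MP/le_trans].
        apply: (le_trans mP); apply: (le_trans (jP m)).
        by apply: mass_mono => //; exact: leq_maxl.
      by apply; apply: mass_mono => //; exact: leq_maxr.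
    exists M.+1; rewrite massS sl lE; last by case: zs zsy {lE stt MP} => // zsy; case: yn.
    rewrite massS // -zsy !big_map big_seq [leRHS]big_seq; apply: ler_sum => z zz.
    rewrite ler_wpM2l ?MP //; apply: (ge0 y z.1); rewrite -zsy; exact: map_f.
Qed.

End Simulation.

(** * Removing irrelevant R-steps *)

Section StepData.
Context {R : realType} {S : signature} {V : choiceType}.
Implicit Types (P : {fset adp R S V}) (s t u e : term S V) (p q : position).

(** Lifts a listing of the reducts of a step to a listing of the right-hand sides they come from. *)
Lemma perm_map_ex (A B : eqType) (f : A -> B) (s : seq B) (r : seq A) :
  perm_eq s (map f r) -> exists2 r', perm_eq r' r & s = map f r'.
Proof.
elim: s r => [|x s IH] r sr.
  by move/perm_size: sr; case: r => // _; exists [::].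
have /mapP[y yr xE] : x \in map f r by rewrite -(perm_mem sr) mem_head.
have ry := perm_to_rem yr; have : perm_eq (x :: s) (map f (y :: rem y r)).
  by apply: (perm_trans sr); apply: perm_map.
rewrite /= -xE perm_cons => /IH[r' r'r sE].
exists (y :: r'); last by rewrite /= -xE sE.
by rewrite perm_sym (perm_trans ry) // perm_cons perm_sym.
Qed.

(** A tree step with its data exposed. The right-hand sides are listed as [xs], so that each
    successor remembers its origin even if several reducts coincide. *)
Definition step_at P (b : bool) s mu pi a (sg : V -> term S V) xs : Prop :=
  [/\ a \in P, ANF P (subst sg (lhs a)), b <-> pos_ann s pi,
      omap flat (subterm s pi) = Some (subst sg (lhs a))
    & perm_eq xs (rhs a) /\
      mu = [seq (x.1, reduct s pi b (flag a) sg x.2) | x <- xs] :> seq (R * term S V)].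

Lemma tree_step_data P b s mu : tree_step P b s mu ->
  exists pi a sg xs, step_at P b s mu pi a sg xs.
Proof.
move=> [pi bpi [a [sg [aP anf [_ fl muE]]]]].
have bE : `[< pos_ann s pi >] = b by apply/asboolP/idP => /bpi.
rewrite bE in muE.
have /perm_map_ex[xs xsa ->] : perm_eq mu
    [seq (x.1, reduct s pi b (flag a) sg x.2) | x <- rhs a].
  by apply/eq_seq_msetP.
by exists pi, a, sg, xs.
Qed.

Lemma root_flat t f : root_sym (flat t) = Some (Def f) ->
  root_sym t = Some (Def f) \/ root_sym t = Some (Ann f).
Proof. by case: t => [//|[c|g|g] ts] //= [->]; [left|right]. Qed.

Lemma root_subst (sg : V -> term S V) t g :
  root_sym t = Some g -> root_sym (subst sg t) = Some g.
Proof. by case: t. Qed.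

Lemma data_tree_step P b s mu pi a sg xs :
  (exists f, root_sym (lhs a) = Some (Def f)) ->
  step_at P b s mu pi a sg xs -> tree_step P b s mu.
Proof.
move=> [f lf] [aP anf bpi fl [xsa ->]].
have bE : `[< pos_ann s pi >] = b by apply/asboolP/idP => /bpi.
exists pi => //; exists a, sg; split=> //; split=> //.
  rewrite /pos_def /pos_ann; case: subterm fl => //= v [fv].
  have := @root_flat v f; rewrite fv (root_subst _ lf) => /(_ erefl).
  by case=> ->; [left|right]; exists f.
by rewrite bE /mset_map; apply/eq_seq_msetP; apply: perm_map.
Qed.

Definition regular_step P (b : bool) s (mu : seq (R * term S V)) : Prop :=
  exists pi a sg xs, step_at P b s mu pi a sg xs /\ b || flag a.

Lemma root_replace t i p e : root_sym (replace t (i :: p) e) = root_sym t.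
Proof. by case: t. Qed.

(** The redex is matched after flattening, so the matcher has no annotations on the variables of
    [l]. *)
Lemma subst_plain (sg : V -> term S V) l s pi r :
  omap flat (subterm s pi) = Some (subst sg l) ->
  flat r = r -> vars r `<=` vars l -> flat (subst sg r) = subst sg r.
Proof.
case: subterm => //= v [vE] rp rl; apply: flat_subst => // x /rl.
by apply: plain_subst_inv; rewrite -vE flat_flat.
Qed.

End StepData.

(** * Agreement at and below annotated positions *)

Section StageA.
Context {R : realType} {S : signature} {V : choiceType}.
Implicit Types (P : {fset adp R S V}) (s t u e : term S V) (p q : position).

(** The relation maintained while steps are skipped: [u] may differ from [t] wherever no annotation
    of [t] lies at or above. *)
Definition agree_ann t u : Prop := forall p, pos_ann t p -> subterm u p = subterm t p.

Lemma pos_ann_replace_above t p q e u : subterm t (p ++ q) = Some u -> q <> [::] ->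
  pos_ann (replace t (p ++ q) e) p -> pos_ann t p.
Proof.
rewrite subterm_cat; case tp : (subterm t p) => [v|] //= vq q0 [f].
rewrite (subterm_replace_above _ _ tp) /= => rf; exists f; rewrite tp /=.
by case: q q0 vq rf => // i q _ _; rewrite root_replace.
Qed.

Lemma agree_replace s u p v e : agree_ann s u -> subterm s p = Some v ->
  subterm u p = Some v -> agree_ann (replace s p e) (replace u p e).
Proof.
move=> su sp up q; have [pq|[[r ->]|[i [r pE]]]] := pos_cases p q.
- by rewrite /pos_ann !subterm_replace_par //; exact: su.
- by rewrite (subterm_replace _ _ sp) (subterm_replace _ _ up).
- rewrite {p}pE in sp up *; move=> qa.
  have /su : pos_ann s q by exact: (pos_ann_replace_above sp _ qa).
  move: sp; rewrite subterm_cat.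
  case E : (subterm s q) => [w|] //= _ uq.
  by rewrite (subterm_replace_above _ _ E) (subterm_replace_above _ _ uq).
Qed.

Lemma agree_flat_above s u p : agree_ann s u ->
  agree_ann (flat_above p s) (flat_above p u).
Proof.
move=> su q qa; have pq : ~~ prefix q p || (q == p).
  apply/orP; case: (boolP (prefix q p)) => [qp|]; [right|by left].
  by apply/negPn/negP => nqp; apply: (pos_ann_flat_above qp nqp qa).
rewrite !subterm_flat_above //; apply: su; move: qa.
by rewrite /pos_ann subterm_flat_above.
Qed.

Lemma agree_skip s u p v e (m : bool) : agree_ann s u -> subterm s p = Some v ->
  flat e = e -> (m = false \/ forall q, prefix q p -> ~ pos_ann s q) ->
  agree_ann (if m then replace s p e else flat_above p (replace s p e)) u.
Proof.
move=> su sp ep ma; have dis q : ~~ prefix q p || (q == p) ->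
    pos_ann (replace s p e) q -> pos_ann s q /\ subterm (replace s p e) q = subterm s q.
  move=> qp; have [pq|[[r ->]|[i [r pE]]]] := pos_cases p q.
  - by rewrite /pos_ann !subterm_replace_par.
  - by rewrite /pos_ann (subterm_replace _ _ sp) => /(plain_pos_ann ep).
  - by move: qp; rewrite pE prefix_prefix /= => /eqP/(congr1 size)/eqP;
       rewrite size_cat /= -[eqbLHS]addn0 eqn_add2l.
case: m ma => [[//|noa]|_] q qa.
  have [qp|qp] := boolP (prefix q p && (q != p)); last first.
    have [|qs ->] := dis q _ qa; last exact: su.
    by move: qp; rewrite negb_and negbK.
  case/andP: qp => /prefixP[r pE] qp; case: (noa q); first by rewrite pE prefix_prefix.
  rewrite {}pE in qp qa sp; apply: (pos_ann_replace_above sp) qa.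
  by move=> r0; rewrite r0 cats0 eqxx in qp.
have qp : ~~ prefix q p || (q == p).
  apply/orP; case: (boolP (prefix q p)) => [qp|]; [right|by left].
  by apply/negPn/negP => nqp; apply: (pos_ann_flat_above qp nqp qa).
move: qa; rewrite /pos_ann subterm_flat_above // => qa.
by have [qs ->] := dis q qp qa; exact: su.
Qed.

(** A step at or below an annotation that is a P-step or has flag true acts on a subterm shared with
    [u] and is repeated there. After any other step no annotation is left at or above its position,
    so the unchanged [u] agrees with every reduct. *)
Lemma agree_step P b s mu : adp_problem P -> tree_step P b s mu ->
  (forall u, agree_ann s u -> exists zs : seq ((R * term S V) * term S V),
     [/\ map fst zs = mu, regular_step P b u [seq (z.1.1, z.2) | z <- zs]
       & forall z, z \in zs -> agree_ann z.1.2 z.2])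
  \/ (~~ b /\ forall u y, agree_ann s u -> y \in mu -> agree_ann y.2 u).
Proof.
move=> adpP /tree_step_data[pi [a [sg [xs [aP anf bpi fl [xsa ->]]]]]].
have [v sv] : exists v, subterm s pi = Some v by case: subterm fl => // v; exists v.
have adpa := adpP a aP; have [_ _ _ rvars] := adpa.
have [[ba [q qpi qa]]|nkeep] :=
  pselect (b || flag a /\ exists2 q, prefix q pi & pos_ann s q).
  left=> u su; have uv : subterm u pi = Some v.
    by case/prefixP: qpi sv => r ->; rewrite !subterm_cat (su q qa).
  exists [seq ((x.1, reduct s pi b (flag a) sg x.2), reduct u pi b (flag a) sg x.2) | x <- xs].
  split; first by rewrite -map_comp.
    rewrite -map_comp; exists pi, a, sg, xs; split=> //.
    have ub : b <-> pos_ann u pi by rewrite bpi /pos_ann sv uv.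
    have ufl : omap flat (subterm u pi) = Some (subst sg (lhs a)) by rewrite uv -sv.
    by split.
  move=> _ /mapP[x xx ->] /=.
  have ar (e : term S V) := @agree_replace s u pi v e su sv uv.
  by rewrite /reduct; case: (b); case: (flag a); rewrite //; apply: agree_flat_above.
right; have nb : ~~ b.
  apply/negP => bT; apply: nkeep; rewrite bT; split=> //; exists pi; last exact/bpi.
  by rewrite prefix_refl.
split=> // u _ su /mapP[x xx ->] /=; rewrite (negbTE nb) /=.
have ep : flat (subst sg (flat x.2)) = subst sg (flat x.2).
  apply: (subst_plain fl); rewrite ?flat_flat // vars_flat; apply: rvars.
  by rewrite -(perm_mem xsa).
have := @agree_skip s u pi v _ (flag a) su sv ep; rewrite /reduct; case: (flag a) nkeep => nkeep.
  apply; right => q qp qa; apply: nkeep; split; first by rewrite orbT.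
  by exists q.
by apply; left.
Qed.

End StageA.

(** * Limit masses and successors of minimal limit mass *)

Section SupMass.
Context {R : realType} {Q : eqType} (succ : Q -> seq (R * Q)).
Hypothesis succ_rng : forall x y, y \in succ x -> 0 < y.1 <= 1.
Hypothesis succ_sum : forall x, succ x <> [::] -> \sum_(y <- succ x) y.1 = 1.

Let succ_ge0 x y : y \in succ x -> 0 <= y.1.
Proof. by move/succ_rng/andP => [/ltW]. Qed.

(** Minimality of a successor is measured by the limit, since the minimal successor at a fixed depth
    could change with the depth. *)
Definition supmass x : R := sup [set mass succ n x | n in [set: nat]].

Lemma mass_supmass n x : mass succ n x <= supmass x.
Proof.
apply: ub_le_sup; last by exists n.
by exists 1 => _ [m _ <-]; exact: mass_le1.
Qed.

Lemma supmass_le b x : (forall n, mass succ n x <= b) -> supmass x <= b.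
Proof.
by move=> mb; apply: ge_sup; [exists (mass succ 0 x), 0%N|move=> _ [n _ <-]].
Qed.

(** At a common depth [N] the finitely many successors all come within [eps] of their limits. *)
Lemma supmass_avg x : succ x <> [::] ->
  \sum_(y <- succ x) y.1 * supmass y.2 <= supmass x.
Proof.
move=> x0; apply/ler_addgt0Pr => eps eps0.
have [N NP] : exists N, forall y, y \in succ x -> supmass y.2 - eps <= mass succ N y.2.
  elim: (succ x) => [|y s [N NP]]; first by exists 0%N.
  have [_ [m _ <-] mE] : exists2 e, [set mass succ n y.2 | n in [set: nat]] e
      & supmass y.2 - eps < e.
    apply: sup_adherent => //; split; first by exists (mass succ 0 y.2), 0%N.
    by exists 1 => _ [m _ <-]; exact: mass_le1.
  exists (maxn m N) => z; rewrite inE => /predU1P[->|/NP/le_trans].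
    by apply: (le_trans (ltW mE)); apply: mass_mono; rewrite ?leq_maxl.
  by apply; apply: mass_mono; rewrite ?leq_maxr.
rewrite -lerBlDr; apply: le_trans (mass_supmass N.+1 x).
rewrite massS // -[in leLHS](mulr1 eps) -(succ_sum x0) mulr_sumr -sumrB.
rewrite big_seq [leRHS]big_seq; apply: ler_sum => y yx.
by rewrite [eps * _]mulrC -mulrBr ler_wpM2l ?NP ?(succ_ge0 yx).
Qed.

Lemma supmass_min x : succ x <> [::] ->
  exists2 y, y \in succ x & supmass y.2 <= supmass x.
Proof.
move=> x0; apply: contrapT => no.
have lt y : y \in succ x -> supmass x < supmass y.2.
  by move=> yx; rewrite ltNge; apply/negP => le; apply: no; exists y.
have := supmass_avg x0; apply/negP; rewrite -ltNge.
rewrite -[ltLHS]mulr1 -(succ_sum x0) mulr_sumr.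
case: (succ x) x0 lt (@succ_rng x) => [//|z s] _ lt rng; rewrite !big_cons.
apply: ltr_leD.
  by rewrite mulrC ltr_pM2l ?lt ?mem_head //; case/andP: (rng z (mem_head _ _)).
rewrite big_seq [leRHS]big_seq; apply: ler_sum => y yx; rewrite mulrC.
have ys : y \in z :: s by rewrite inE yx orbT.
by rewrite ler_wpM2l ?(ltW (lt _ ys)) //; case/andP: (rng _ ys) => /ltW.
Qed.

End SupMass.

Section StageAResult.
Context {R : realType} {S : signature} {V : choiceType} (P : {fset adp R S V}).
Hypothesis adpP : adp_problem P.

Lemma regular_system (Q : eqType) (lab : Q -> term S V) isP (succ : Q -> seq (R * Q)) x0 :
  system (tree_step P) lab isP succ ->
  (forall x, succ x <> [::] -> \sum_(y <- succ x) y.1 = 1) ->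
  exists (Q' : eqType) (lab' : Q' -> term S V) isP' (succ' : Q' -> seq (R * Q')) x0',
    system (regular_step P) lab' isP' succ' /\
    forall b, (forall n, mass succ n x0 <= b) -> forall n, mass succ' n x0' <= b.
Proof.
move=> [step rng acc] sum1.
(* Kept nodes are singled out by the simulation property itself; [agree_step] shows that all
   remaining nodes can be skipped. *)
pose keep x := `[< forall u, agree_ann (lab x) u ->
  exists zs : seq ((R * Q) * term S V),
     [/\ map fst zs = succ x, regular_step P (isP x) u [seq (z.1.1, z.2) | z <- zs]
       & forall z, z \in zs -> agree_ann (lab z.1.2) z.2] >].
have skip x : succ x <> [::] -> ~~ keep x -> ~~ isP x /\
    forall u y, agree_ann (lab x) u -> y \in succ x -> agree_ann (lab y.2) u.
  move=> xn /asboolPn nk; have [k|[nP sk]] := agree_step adpP (step x xn).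
    case: nk => u /k[zs [zsx st ag]].
    (* [agree_step] couples labels only; zipping with [succ x] restores the states behind them. *)
    pose zs' := zip (succ x) (map snd zs).
    have szE : size (succ x) = size (map snd zs).
      by have /(congr1 size) := zsx; rewrite !size_map.
    exists zs'; split.
    - by rewrite -/(unzip1 _) unzip1_zip // szE.
    - move: st; congr (regular_step P _ _ _); apply: (@eq_from_nth _ (0, u)).
        by rewrite !size_map size_zip -szE minnn szE size_map.
      move=> i; rewrite size_map => izs.
      have ix : (i < size (succ x))%N by rewrite szE size_map.
      rewrite (nth_map ((0, u), u)) // (nth_map ((0, x), u)) ?size_zip -?szE ?minnn //.
      rewrite nth_zip // (nth_map ((0, u), u)) //=; congr pair.
      have := congr1 (fun l => (nth (0, u) l i).1) zsx.
      by rewrite /= (nth_map ((0, u), u)) // (nth_map (0, x)).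
    - move=> z /(nthP ((0, x), u))[i]; rewrite size_zip -szE minnn => ix <-.
      have izs : (i < size zs)%N by rewrite szE size_map in ix.
      rewrite nth_zip // (nth_map ((0, u), u)) //=.
      have := ag _ (mem_nth ((0, u), u) izs); congr agree_ann.
      have := congr1 (fun l => (nth (0, u) l i).2) zsx.
      by rewrite /= (nth_map ((0, u), u)) // (nth_map (0, x)).
  split=> // u y xu yx; apply: (sk u (y.1, lab y.2)) => //.
  by apply/mapP; exists y.
have minc x : exists y, succ x <> [::] -> y \in map snd (succ x) /\ supmass succ y <= supmass succ x.
  have [x0E|/(supmass_min rng sum1)[y yx le]] := pselect (succ x = [::]); first by exists x.
  by exists y.2 => _; split=> //; apply: map_f.
have [c cP] := choice minc.
pose succA x := if nilp (succ x) || keep x then succ x else [:: (1, c x)].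
have nilA x : succA x <> [::] -> succ x <> [::] by rewrite /succA => + sx; rewrite sx.
have rngA x y : y \in succA x -> 0 < y.1 <= 1.
  by rewrite /succA; case: ifP => _; [exact: rng|rewrite inE => /eqP -> /=; rewrite ltr01 lexx].
have accA x : Acc (Rsucc succA isP) x.
  elim: (acc x) => y _ IH; constructor=> z [nP [p pz]]; apply: IH; split=> //.
  move: pz; rewrite /succA; case: ifP => [_ pz|/negbT]; first by exists p.
  rewrite negb_or => /andP[/nilP yn _]; rewrite inE => /eqP[_ ->].
  by have [/mapP[w wy ->] _] := cP y yn; exists w.1; rewrite -surjective_pairing.
have simA x t : agree_ann (lab x) t -> succA x <> [::] ->
    exists k s, dets (regular_step P) k t s /\
      ((exists b zs, matches (regular_step P) isP succA (fun x => agree_ann (lab x)) x b s zs)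
       \/ (exists y, [/\ succA x = [:: (1, y)], ~~ isP x & agree_ann (lab y) s])).
  move=> xt xn; exists 0%N, t; split=> //; have {}xn := nilA x xn.
  have xE : nilp (succ x) = false by apply/nilP.
  rewrite /matches /succA xE /=; case: ifP => [/asboolP/(_ t xt)[zs [e st ag]]|/negbT kx].
    by left; exists (isP x), zs.
  right; exists (c x); have [nP sk] := skip x xn kx; split=> //.
  by have [/mapP[w wx ->] _] := cP x xn; apply: sk.
have agr : agree_ann (lab x0) (lab x0) by [].
have [Q' [lab' [isP' [succ' [x' [sys' mb]]]]]] := simulation rngA accA simA agr.
exists Q', lab', isP', succ', x'; split=> // b bP; apply: mb => n.
apply: le_trans (supmass_le bP).
(* Finite masses of the pruned system are compared with limits of the original one, because its
   successors are minimal with respect to limits. *)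
move: n; suff H : forall n x, mass succA n x <= supmass succ x by move=> n; exact: H.
elim=> [|n IH] x; have [xn|xn] := boolP (nilp (succ x)).
- apply: le_trans (mass_supmass rng sum1 0 x).
  by rewrite !mass_leaf // /succA ?xn; apply/nilP.
- apply: (@le_trans _ _ 0).
    rewrite /=; case: ifP => //; rewrite /succA (negbTE xn) /=.
    by case: ifP => // _; rewrite (negbTE xn).
  by apply: le_trans (mass_supmass rng sum1 0 x); apply: mass_ge0 => y z /rng/andP[/ltW].
- apply: le_trans (mass_supmass rng sum1 0 x).
  by rewrite !mass_leaf // /succA ?xn; apply/nilP.
have xs0 : succ x <> [::] by apply/nilP.
have xA : succA x <> [::] by rewrite /succA (negbTE xn) /=; case: ifP.
rewrite massS // /succA (negbTE xn) /=; case: ifP => kx.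
  apply: le_trans (supmass_avg rng sum1 xs0).
  rewrite big_seq [leRHS]big_seq; apply: ler_sum => y yx.
  by rewrite ler_wpM2l ?IH //; case/andP: (rng _ _ yx) => /ltW.
by rewrite big_seq1 mul1r; apply: (le_trans (IH _)); have [] := cP x xs0.
Qed.

End StageAResult.

(** * Terms that agree up to pending redexes *)

Section PendingSim.
Context {S : signature} {V : choiceType}.
Implicit Types (s t u v w e : term S V) (p q : position) (c : position -> option nat).
Context (Pend : nat -> term S V -> term S V -> Prop).

(* [psim c t u]: the terms agree except at the positions in the domain of [c],
   which are pairwise parallel and carry a pair of subterms related by [Pend]. *)
Fixpoint psim c t u {struct t} : Prop :=
  if c [::] is Some k then Pend k t u /\ (forall p, p <> [::] -> c p = None)
  else match t with
  | Var x => u = Var x /\ (forall p, c p = None)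
  | App g ts =>
      (exists2 us, u = App g us & forall i, psim (fun p => c (val i :: p)) (ts i) (us i))
      /\ (forall n p, (arity g <= n)%N -> c (n :: p) = None)
  end.

Lemma psim_here c t u k : c [::] = Some k ->
  psim c t u <-> Pend k t u /\ (forall p, p <> [::] -> c p = None).
Proof. by case: t => [x|g ts] /= ->. Qed.

Lemma psim_App c (g : sym S) (ts : 'I_(arity g) -> term S V) u : c [::] = None ->
  psim c (App g ts) u <->
  (exists2 us, u = App g us & forall i, psim (fun p => c (val i :: p)) (ts i) (us i))
  /\ (forall n p, (arity g <= n)%N -> c (n :: p) = None).
Proof. by move=> /= ->. Qed.

Lemma psim_refl t : psim (fun=> None) t t.
Proof. by elim: t => [x|g ts IH] //=; split=> //; exists ts. Qed.

Lemma psim_eq c t u : (forall p, c p = None) -> psim c t u -> u = t.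
Proof.
elim: t c u => [x|g ts IH] c u c0 /=; rewrite c0; first by case.
case=> [[us -> us_sim] _]; apply: eq_App => i.
by apply: (IH i _ _ _ (us_sim i)) => p.
Qed.

Lemma psim_pend c t u p k : psim c t u -> c p = Some k ->
  exists v w, [/\ subterm t p = Some v, subterm u p = Some w, Pend k v w,
                  forall q i r, p = q ++ i :: r -> c q = None
                & forall r, r <> [::] -> c (p ++ r) = None].
Proof.
elim: p c t u => [|n p IH] c t u tu cp.
  have [pe c0] := (psim_here t u cp).1 tu.
  by exists t, u; split=> //; rewrite ?subterm_nil // => -[].
case E : (c [::]) => [k'|].
  by have [_ c0] := (psim_here t u E).1 tu; rewrite c0 in cp.
case: t tu => [x|g ts]; first by rewrite /= E => -[_ c0]; rewrite c0 in cp.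
move/(psim_App ts u E) => [[us -> us_sim] out].
have gn : (n < arity g)%N.
  by rewrite ltnNge; apply/negP => gn; rewrite out in cp.
have [v [w [v1 w1 pe ab be]]] := IH _ _ _ (us_sim (Ordinal gn)) cp.
exists v, w; rewrite -[n]/(val (Ordinal gn)) !subterm_App; split=> //.
by move=> [|m q] i r //= [<- pE]; apply: ab pE.
Qed.

Lemma psim_sub c t u p v : psim c t u -> subterm t p = Some v ->
  (forall q i r, p = q ++ i :: r -> c q = None) ->
  exists2 w, subterm u p = Some w & psim (fun r => c (p ++ r)) v w.
Proof.
elim: p c t u => [|n p IH] c t u.
  by rewrite subterm_nil => tu [<-] _; exists u => //; rewrite subterm_nil.
case: t => [x|g ts] // tu /subterm_cons[i nE tp] ab; subst n.
have c0 : c [::] = None by exact: (ab [::] (val i) p).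
have [[us -> us_sim] out] := (psim_App ts u c0).1 tu.
have [|w uw vw] := IH _ _ _ (us_sim i) tp.
  by move=> q j r pE; apply: (ab (val i :: q) j r); rewrite pE.
by exists w => //; rewrite subterm_App.
Qed.

(** The marking after a replacement at [p]: marks at or below [p] are those of the new subterm. *)
Definition graft c p c1 : position -> option nat :=
  fun q => if prefix p q then c1 (drop (size p) q) else c q.

Lemma graft_cons c i p c1 j :
  (fun q => graft c (i :: p) c1 (j :: q)) =
  if j == i then graft (fun q => c (i :: q)) p c1 else fun q => c (j :: q).
Proof.
apply: funext => q; rewrite /graft prefix_cons [i == j]eq_sym.
by case: eqVneq => [->|].
Qed.

Lemma psim_replace c c1 t u p v e e' : psim c t u -> subterm t p = Some v ->
  (forall q i r, p = q ++ i :: r -> c q = None) -> psim c1 e e' ->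
  psim (graft c p c1) (replace t p e) (replace u p e').
Proof.
move=> + + + ee'; elim: p c t u => [|n p IH] c t u.
  move=> _ _ _; rewrite !replace_nil (_ : graft _ _ _ = c1) //.
  by apply: funext => q; rewrite /graft prefix0s drop0.
case: t => [x|g ts] // tu /subterm_cons[i nE tp] ab; subst n.
have c0 : c [::] = None by exact: (ab [::] (val i) p).
have [[us -> us_sim] out] := (psim_App ts u c0).1 tu.
rewrite !replace_App; apply/psim_App; first exact: c0.
split; last first.
  move=> n q gn; rewrite /graft prefix_cons; case: eqP => [iE|_] /=; last exact: out.
  by move: gn; rewrite -iE leqNgt ltn_ord.
exists (fun j => if j == i then replace (us j) p e' else us j) => // j.
rewrite graft_cons val_eqE; case: eqVneq => [->|_]; last exact: us_sim.
by apply: IH => // q k r pE; apply: (ab (val i :: q) k r); rewrite pE.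
Qed.

Lemma psim_unann c (g : sym S) (ts us : 'I_(arity g) -> term S V) : c [::] = None ->
  psim c (App g ts) (App g us) -> psim c (unann_app ts) (unann_app us).
Proof.
move=> c0 /(psim_App ts _ c0)[[us' /App_inj -> us_sim] out].
by case: g ts us us' us_sim out => [d|f|f] ts us us' us_sim out;
   apply/psim_App => //; split=> //; exists us'.
Qed.

Lemma psim_flat_above c t u p v : psim c t u -> subterm t p = Some v ->
  (forall q i r, p = q ++ i :: r -> c q = None) ->
  psim c (flat_above p t) (flat_above p u).
Proof.
elim: p c t u => [|n p IH] c t u; first by rewrite !flat_above_nil.
case: t => [x|g ts] // tu /subterm_cons[i nE tp] ab; subst n.
have c0 : c [::] = None by exact: (ab [::] (val i) p).
have [[us -> us_sim] out] := (psim_App ts u c0).1 tu.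
apply: psim_unann => //; apply/psim_App => //; split=> //.
exists (fun j : 'I_(arity g) => if val j == val i then flat_above p (us j) else us j) => // j.
rewrite val_eqE; case: eqVneq => [->|_]; last exact: us_sim.
by apply: IH => // q k r pE; apply: (ab (val i :: q) k r); rewrite pE.
Qed.

Definition setc c p (o : option nat) : position -> option nat :=
  fun q => if q == p then o else c q.

Lemma graft_none c p : (forall r, c (p ++ r) = None) -> graft c p (fun=> None) = c.
Proof.
move=> cp; apply: funext => q; rewrite /graft; case: ifP => // /prefixP[r ->].
by rewrite cp.
Qed.

Lemma graft_setc c p q k : (forall r, c (p ++ r) = None) ->
  graft c p (setc (fun=> None) q (Some k)) = setc c (p ++ q) (Some k).
Proof.
move=> cp; apply: funext => r; rewrite /graft /setc; case: ifP => [/prefixP[s ->]|npr].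
  by rewrite drop_size_cat // eqseq_cat // eqxx /= cp.
by case: eqP npr => // ->; rewrite prefix_prefix.
Qed.

Lemma graft_clear c p : (forall r, r <> [::] -> c (p ++ r) = None) ->
  graft c p (fun=> None) = setc c p None.
Proof.
move=> cp; apply: funext => q; rewrite /graft /setc; case: ifP => [/prefixP[r ->]|npr].
  case: eqP => // rp; rewrite cp // => r0; by rewrite r0 cats0 in rp.
by case: eqP npr => // ->; rewrite prefix_refl.
Qed.

Lemma graft_keep c p k : c p = Some k -> (forall r, r <> [::] -> c (p ++ r) = None) ->
  graft c p (setc (fun=> None) [::] (Some k)) = c.
Proof.
move=> ck cp; apply: funext => q; rewrite /graft /setc; case: ifP => // /prefixP[r ->].
rewrite drop_size_cat //; case: eqP => [->|r0]; first by rewrite cats0.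
by rewrite cp.
Qed.

Lemma psim_point k t u : Pend k t u -> psim (setc (fun=> None) [::] (Some k)) t u.
Proof.
move=> tu; have e : setc (fun=> None) [::] (Some k) [::] = Some k by [].
by apply: (psim_here t u e).2; split=> // p p0; rewrite /setc; case: eqP.
Qed.

End PendingSim.

Section Normal.
Context {R : realType} {S : signature} {V : choiceType}.
Implicit Types (P : {fset adp R S V}) (s t u v : term S V) (p q : position).

Lemma nf_flat P t : normal_form P (flat t) <-> normal_form P t.
Proof. by rewrite /normal_form flat_flat. Qed.

Lemma nf_sub P t p u : normal_form P t -> subterm t p = Some u -> normal_form P u.
Proof.
move=> nt tp q v uv; apply: (nt (p ++ q)).
by rewrite subterm_cat subterm_flat tp.
Qed.

Lemma redex_not_nf P t a (sg : V -> term S V) :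
  a \in P -> flat t = subst sg (lhs a) -> ~ normal_form P t.
Proof.
move=> aP tE nt; apply: (nt [::] (flat t)); first by rewrite subterm_nil.
by exists a, sg.
Qed.

Lemma anf_sub P t p u : ANF P t -> p <> [::] -> subterm t p = Some u -> normal_form P u.
Proof. by move=> at_ /eqP p0 tp; apply: at_ tp. Qed.

Lemma nf_mono P P2 t : (forall a, a \in P2 -> exists2 b, b \in P & lhs a = lhs b) ->
  normal_form P t -> normal_form P2 t.
Proof.
move=> sub nt p u tp [a [sg [/sub[b bP ab] uE]]]; apply: (nt p u tp).
by exists b, sg; rewrite -ab.
Qed.

Lemma anf_mono P P2 t : (forall a, a \in P2 -> exists2 b, b \in P & lhs a = lhs b) ->
  ANF P t -> ANF P2 t.
Proof. by move=> sub at_ p u p0 tp; apply: (nf_mono sub); apply: at_ tp. Qed.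

Lemma seq_mset_cat (K : choiceType) (s1 s2 : seq K) :
  seq_mset (s1 ++ s2) = (seq_mset s1 `+` seq_mset s2)%mset.
Proof. by apply/msetP => x; rewrite msetE2 !mset_seqE count_cat. Qed.

Lemma seq_mset_consB (K : choiceType) (x : K) (s : seq K) :
  (seq_mset (x :: s) `\ x)%mset = seq_mset s.
Proof. by rewrite -cat1s seq_mset_cat (_ : seq_mset [:: x] = [mset x]) ?msetD1K //;
  apply/msetP => y; rewrite mset_seqE msetnE /= addn0 eq_sym; case: eqP. Qed.

End Normal.

(** * The rewriting processor *)

Section Processor.
Context {R : realType} {S : signature} {V : choiceType}.
Implicit Types (s t u v w e : term S V) (p q : position) (c : position -> option nat)
  (a : adp R S V) (sg : V -> term S V).
Context (P P' P'' : {fset adp R S V}) (alpha : adp R S V) (adpP : adp_problem P)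
  (P_split : P = (alpha |` P')%fset) (pj : R) (rj : term S V)
  (rj_in : (pj, rj) \in rhs alpha) (tau : position) (rj_tau : term S V)
  (rj_tau_def : subterm rj tau = Some rj_tau) (rj_tau_plain : flat rj_tau = rj_tau)
  (beta : adp R S V) (sgb : V -> term S V) (betaP : beta \in P)
  (beta_true : flag beta = true) (rj_tauE : rj_tau = subst sgb (lhs beta)).

Definition rewr (x : R * term S V) : term S V := replace rj tau (subst sgb (flat x.2)).

Context (qe : {mset (R * term S V)%type})
  (qeE : qe = mset_map (fun x => (x.1, rewr x)) (rhs beta))
  (P''_def : P'' = (P' `|` [fset flat_adp alpha; rewritten_adp alpha pj rj qe])%fset).

Lemma alphaP : alpha \in P. Proof. by rewrite P_split !inE eqxx. Qed.

(** [P''] has no new left-hand sides, so normal forms of [P] stay normal and innermost steps stay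
    innermost. *)
Lemma lhs_P'' a : a \in P'' -> exists2 b, b \in P & lhs a = lhs b.
Proof.
rewrite P''_def P_split !inE => /orP[aP|/orP[] /eqP ->].
- by exists a; rewrite // !inE aP orbT.
- by exists alpha; rewrite // !inE eqxx.
- by exists alpha; rewrite // !inE eqxx.
Qed.

Lemma lhs_root a : a \in P -> exists f, root_sym (lhs a) = Some (Def f).
Proof. by case/adpP. Qed.

Lemma reductE s pi b m sg r : reduct s pi b m sg r =
  (if m then id else flat_above pi) (replace s pi (subst sg (if b then r else flat r))).
Proof. by case: b; case: m. Qed.

(** An R-step flattens the right-hand side anyway, so a step with [alpha] is performed equally well
    by its flattened copy in [P'']. *)
Lemma reduct_step a sg s u pi (xs : seq (R * term S V)) : a \in P -> flag a = true ->
  ANF P (subst sg (lhs a)) -> subterm u pi = Some s -> flat s = subst sg (lhs a) ->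
  ~ pos_ann u pi -> perm_eq xs (rhs a) ->
  tree_step P'' false u [seq (x.1, replace u pi (subst sg (flat x.2))) | x <- xs].
Proof.
move=> aP am anf us sE nann xsa.
have fl : omap flat (subterm u pi) = Some (subst sg (lhs a)) by rewrite us /= sE.
have anf'' := anf_mono lhs_P'' anf; have rt := lhs_root aP.
move: (aP); rewrite P_split !inE => /orP[/eqP aE|aP'].
  subst a; apply: (@data_tree_step _ _ _ _ _ _ _ pi (flat_adp alpha) sg
    [seq (x.1, flat x.2) | x <- xs]) => //.
  split=> //; first by rewrite P''_def !inE eqxx orbT.
  rewrite /= am -map_comp; split.
    by rewrite perm_sym (perm_trans (perm_eq_seq_mset _)) // perm_map // perm_sym.
  by apply: eq_map => x /=; rewrite flat_flat.
apply: (@data_tree_step _ _ _ _ _ _ _ pi a sg xs) => //; split=> //.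
  by rewrite P''_def !inE aP'.
by rewrite am; split=> //; apply: eq_map => x; rewrite reductE.
Qed.

Lemma lhs_vars_nf a sg x : a \in P -> ANF P (subst sg (lhs a)) -> vars (lhs a) x ->
  normal_form P (sg x).
Proof.
move=> aP anf [p lp]; apply: (anf_sub anf (p := p)); last exact: (subterm_subst sg lp).
move=> p0; have [f] := lhs_root aP; move: lp.
by rewrite p0 subterm_nil => -[->].
Qed.

Lemma rhs_vars a x : a \in P -> x \in rhs a -> vars x.2 `<=` vars (lhs a).
Proof. by case/adpP => _ _ _; apply. Qed.

(** * Repeating steps of [P] with [P''] away from waiting redexes *)

Section Mimic.
Context (Pend : nat -> term S V -> term S V -> Prop).
Hypothesis Pend_redex : forall k v w, Pend k v w -> ~ normal_form P v.
Hypothesis Pend_init : forall sg k, (k < size (rhs beta))%N ->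
  (forall y, vars rj_tau y -> normal_form P (sg y) /\ flat (sg y) = sg y) ->
  Pend k (subst sg rj_tau) (subst sg (subst sgb (flat (nth (0, rj) (rhs beta) k).2))).

Lemma psim_reduct c c1 t u pi s e e' (m : bool) : psim Pend c t u ->
  subterm t pi = Some s -> (forall q i r, pi = q ++ i :: r -> c q = None) ->
  psim Pend c1 e e' ->
  psim Pend (graft c pi c1) ((if m then id else flat_above pi) (replace t pi e))
    ((if m then id else flat_above pi) (replace u pi e')).
Proof.
move=> tu ts ab ee'; have rep := psim_replace tu ts ab ee'.
case: m => //; apply: (psim_flat_above rep (subterm_replace_eq _ ts)).
move=> q i r piE; rewrite /graft; case: ifP => [/prefixP[r' qE]|_]; last exact: ab piE.
move/(congr1 size): piE; rewrite qE !size_cat /= => /eqP.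
by rewrite -addnA -[eqbLHS]addn0 eqn_add2l addnS.
Qed.

(** A waiting redex is not normal, so none lies properly inside an innermost redex. If none lies at
    or above it either, the redex is literally the same in both terms. *)
Lemma no_pend_sub c t u pi s : psim Pend c t u -> subterm t pi = Some s ->
  ANF P (flat s) -> (forall q, prefix q pi -> c q = None) ->
  [/\ subterm u pi = Some s, forall r, c (pi ++ r) = None
    & forall q i r, pi = q ++ i :: r -> c q = None].
Proof.
move=> tu ts anf np.
have ab q i r : pi = q ++ i :: r -> c q = None.
  by move=> piE; apply: np; rewrite piE prefix_prefix.
have be r : c (pi ++ r) = None.
  case E : (c _) => [k|] //; have [v [w [tv _ pe _ _]]] := psim_pend tu E.
  have r0 : r <> [::] by move=> r0; rewrite r0 cats0 np ?prefix_refl in E.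
  case: (Pend_redex pe); apply/nf_flat; apply: (anf_sub anf r0).
  by move: tv; rewrite subterm_cat ts /= subterm_flat => ->.
split=> //; have [w uw sw] := psim_sub tu ts ab.
by rewrite uw (psim_eq be sw).
Qed.

Lemma mimic c t u (b : bool) mu pi a sg xs : psim Pend c t u ->
  step_at P b t mu pi a sg xs -> b || flag a ->
  (forall q, prefix q pi -> c q = None) -> ~ (b /\ a = alpha) ->
  tree_step P'' b u [seq (x.1, reduct u pi b (flag a) sg x.2) | x <- xs] /\
  forall x, x \in xs ->
    psim Pend c (reduct t pi b (flag a) sg x.2) (reduct u pi b (flag a) sg x.2).
Proof.
move=> tu [aP anf bpi fl [xsa _]] ba np nba.
have [s ts sE] : exists2 s, subterm t pi = Some s & flat s = subst sg (lhs a).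
  by case: (subterm t pi) fl => //= s [sE]; exists s.
have anfs : ANF P (flat s) by rewrite sE.
have [us be ab] := no_pend_sub tu ts anfs np.
split; last first.
  move=> x _; rewrite !reductE -{1}(graft_none be).
  by apply: (psim_reduct _ tu ts ab); exact: psim_refl.
have bu : b <-> pos_ann u pi by rewrite bpi /pos_ann us ts.
case: b ba bpi bu nba => ba bpi bu nba.
  apply: (@data_tree_step _ _ _ _ _ _ _ pi a sg xs); first exact: lhs_root.
  split=> //; last by rewrite us /= sE.
  - move: aP; rewrite P_split P''_def !inE => /orP[/eqP aE|->] //.
    by case: nba.
  - exact: anf_mono lhs_P'' anf.
have -> : [seq (x.1, reduct u pi false (flag a) sg x.2) | x <- xs] =
          [seq (x.1, replace u pi (subst sg (flat x.2))) | x <- xs].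
  by apply: eq_map => x; rewrite reductE /= in ba *; rewrite ba.
by apply: (reduct_step aP ba anf us sE) => // /bu.
Qed.

Lemma perm_rewritten xs1 : perm_eq ((pj, rj) :: xs1) (rhs alpha) ->
  perm_eq ([seq (pj * x.1, rewr x) | x <- rhs beta] ++ xs1)
          (rhs (rewritten_adp alpha pj rj qe)).
Proof.
move=> /eq_seq_msetP; rewrite seq_mset_id => xsE.
apply/eq_seq_msetP; rewrite seq_mset_id /= -xsE seq_mset_consB seq_mset_cat msetDC.
congr (_ `+` _)%mset; rewrite qeE /mset_map; apply/eq_seq_msetP.
rewrite (map_comp (fun x => (pj * x.1, x.2)) (fun x => (x.1, rewr x))).
by apply: perm_map; rewrite perm_sym perm_eq_seq_mset.
Qed.

Lemma subst_rewr sg x : subst sg (rewr x) =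
  replace (subst sg rj) tau (subst sg (subst sgb (flat x.2))).
Proof. by rewrite /rewr (replace_subst _ _ rj_tau_def). Qed.

(** In [t] the instance of [rj] still contains its redex, whereas the rewritten ADP puts the
    contractum with outcome [k] into [u]. The difference is recorded by a new mark [k] at
    [pi ++ tau]. *)
Lemma mimic_alpha c t u mu pi sg xs1 : psim Pend c t u ->
  step_at P true t mu pi alpha sg ((pj, rj) :: xs1) ->
  (forall q, prefix q pi -> c q = None) ->
  [/\ tree_step P'' true u ([seq (pj * x.1, reduct u pi true (flag alpha) sg (rewr x)) | x <- rhs beta]
         ++ [seq (x.1, reduct u pi true (flag alpha) sg x.2) | x <- xs1]),
      forall k, (k < size (rhs beta))%N -> psim Pend (setc c (pi ++ tau) (Some k))
        (reduct t pi true (flag alpha) sg rj)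
        (reduct u pi true (flag alpha) sg (rewr (nth (0%R, rj) (rhs beta) k)))
    & forall x, x \in xs1 -> psim Pend c (reduct t pi true (flag alpha) sg x.2)
        (reduct u pi true (flag alpha) sg x.2)].
Proof.
move=> tu [aP anf bpi fl [xsa _]] np.
have [s ts sE] : exists2 s, subterm t pi = Some s & flat s = subst sg (lhs alpha).
  by case: (subterm t pi) fl => //= s [sE]; exists s.
have anfs : ANF P (flat s) by rewrite sE.
have [us be ab] := no_pend_sub tu ts anfs np.
split.
- have -> : [seq (pj * x.1, reduct u pi true (flag alpha) sg (rewr x)) | x <- rhs beta]
         ++ [seq (x.1, reduct u pi true (flag alpha) sg x.2) | x <- xs1] =
         [seq (x.1, reduct u pi true (flag (rewritten_adp alpha pj rj qe)) sg x.2) |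
            x <- [seq (pj * x.1, rewr x) | x <- rhs beta] ++ xs1].
    by rewrite map_cat -map_comp.
  apply: (@data_tree_step _ _ _ _ _ _ _ pi (rewritten_adp alpha pj rj qe) sg
    ([seq (pj * x.1, rewr x) | x <- rhs beta] ++ xs1)); first exact: lhs_root aP.
  split=> //; last by split=> //; exact: perm_rewritten.
  - by rewrite P''_def !inE eqxx !orbT.
  - exact: anf_mono lhs_P'' anf.
  - by rewrite bpi /pos_ann us ts.
  - by rewrite us /= sE.
- move=> k kb; rewrite !reductE -(graft_setc tau k be).
  apply: (psim_reduct _ tu ts ab); rewrite subst_rewr.
  have init : Pend k (subst sg rj_tau)
      (subst sg (subst sgb (flat (nth (0%R, rj) (rhs beta) k).2))).
    apply: Pend_init => // y yt; have yl : vars (lhs alpha) y.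
      by apply: (rhs_vars aP rj_in); apply: (vars_sub rj_tau_def).
    split; first exact: (lhs_vars_nf aP anf yl).
    by apply: (plain_subst_inv _ yl); rewrite -sE flat_flat.
  have := psim_replace (psim_refl Pend (subst sg rj)) (subterm_subst sg rj_tau_def)
    (fun _ _ _ _ => erefl) (psim_point init).
  rewrite (replace_id (subterm_subst sg rj_tau_def)).
  congr (psim Pend _ _ _); apply: funext => q; rewrite /graft /setc.
  case: ifP => [/prefixP[r ->]|npr]; last by case: eqP npr => // ->; rewrite prefix_refl.
  have -> : (tau ++ r == tau) = (r == [::]) by rewrite -{2}[tau]cats0 eqseq_cat ?eqxx.
  by rewrite drop_size_cat.
- move=> x _; rewrite !reductE -{1}(graft_none be).
  by apply: (psim_reduct _ tu ts ab); exact: psim_refl.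
Qed.

End Mimic.

(** * Consequences of non-overlappingness *)

Section NonOverlapping.
Context (infV : infinite_set [set: V]) (no : non_overlapping (usable P rj_tau)).

Lemma overlap_root a b (s s' : V -> term S V) p u :
  usable P rj_tau a -> usable P rj_tau b -> subterm (lhs b) p = Some u ->
  root_sym u <> None -> subst s (lhs a) = subst s' u -> same_rule a b /\ p = [::].
Proof. by move=> ua ub bp ur e; apply: (no ua ub bp ur (unify_match infV bp e)). Qed.

Lemma usable_sub t p v a : subterm t p = Some v -> usable P v a -> usable P t a.
Proof.
elim: p t => [|n p IH] t; first by rewrite subterm_nil => -[->].
case: t => [x|g ts] // /subterm_cons[i _ tp] va.
by apply: (usable_arg (i := i)); apply: IH tp va.
Qed.

Lemma usable_redex t p v a sg : subterm t p = Some v -> a \in P -> flag a = true ->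
  root_sym v = root_sym (subst sg (lhs a)) -> usable P t a.
Proof.
move=> tp aP am; have [f lf] := lhs_root aP; rewrite (root_subst _ lf).
case: v tp => // g ts tp [gf]; apply: (usable_sub tp).
by apply: usable_root; split=> //; rewrite lf gf.
Qed.

Lemma beta_usable : usable P rj_tau beta.
Proof.
by apply: (usable_redex (p := [::]) (v := rj_tau) (sg := sgb)) => //;
  rewrite ?subterm_nil // -rj_tauE.
Qed.

Lemma root_subst_inv sg t : root_sym t <> None -> root_sym (subst sg t) = root_sym t.
Proof. by case: t. Qed.

(** The root of a redex at a non-variable position of [lhs beta] also occurs in [rj_tau], so its
    rule is usable and non-overlappingness forces it to the root. All other redexes lie inside the
    substitution. *)
Lemma beta_redex (th : V -> term S V) a sg p : a \in P -> flag a = true ->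
  subterm (subst th (lhs beta)) p = Some (subst sg (lhs a)) ->
  (p = [::] /\ same_rule a beta) \/
  (exists p1 p2 x, [/\ p = p1 ++ p2, p1 <> [::], subterm (lhs beta) p1 = Some (Var x)
                     & subterm (th x) p2 = Some (subst sg (lhs a))]).
Proof.
move=> aP am /subterm_substP[[u [bu ur e]]|[p1 [p2 [x [pE bp1 xp2]]]]].
  left; have ua : usable P rj_tau a.
    apply: (@usable_redex _ p (subst sgb u) a sg) => //.
      by rewrite rj_tauE (subterm_subst _ bu).
    by rewrite e !root_subst_inv.
  by have [] := overlap_root ua beta_usable bu ur e.
right; exists p1, p2, x; split=> // p10; have [f] := lhs_root betaP.
by move: bp1; rewrite p10 subterm_nil => -[->].
Qed.

Lemma flat_mdist_perm (mu nu : {mset (R * term S V)}) (xs : seq (R * term S V)) :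
  flat_mdist mu = flat_mdist nu -> perm_eq xs mu ->
  perm_eq [seq (x.1, flat x.2) | x <- xs] [seq (x.1, flat x.2) | x <- nu].
Proof. by move=> /eq_seq_msetP e xsm; apply: perm_trans e; apply: perm_map. Qed.

Section NodeData.
Context (Q : eqType) (lab : Q -> term S V) (isP : Q -> bool) (succ : Q -> seq (R * Q))
  (sys : system (regular_step P) lab isP succ).

(* [zs] pairs the right-hand sides of the ADP applied at [x] with the successors
   of [x], in the order of [beta] if the rule is consumed as [beta]. *)
Definition node_data x (d : position * adp R S V * (V -> term S V) *
    seq ((R * term S V) * Q)) : Prop :=
  let: (pi, a, sg, zs) := d in
  [/\ perm_eq [seq (z.1.1, z.2) | z <- zs] (succ x),
      step_at P (isP x) (lab x) [seq (z.1.1, lab z.2) | z <- zs] pi a sg (map fst zs),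
      isP x || flag a,
      isP x -> a = alpha -> (exists (y : Q) zs1, zs = ((pj, rj), y) :: zs1)
    & ~~ isP x -> same_rule a beta ->
      [seq (z.1.1, flat z.1.2) | z <- zs] = [seq (y.1, flat y.2) | y <- rhs beta]].

Lemma node_data_ex x : succ x <> [::] -> exists d, node_data x d.
Proof.
move=> xn; have [step _ _] := sys; have [pi [a [sg [xs [st ba]]]]] := step x xn.
have [aP anf bpi fl [xsa muE]] := st.
pose zs0 := zip xs (map snd (succ x)).
have szE : size xs = size (succ x) by have := congr1 size muE; rewrite !size_map.
have zs0x : map fst zs0 = xs by rewrite -/(unzip1 _) unzip1_zip // size_map szE.
have zs0s : [seq (z.1.1, z.2) | z <- zs0] = succ x.
  apply: (@eq_from_nth _ (0, x)); first by rewrite size_map size_zip size_map szE minnn.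
  rewrite size_map size_zip size_map szE minnn => i ix.
  rewrite (nth_map ((0, rj), x)) ?size_zip ?size_map ?szE ?minnn //.
  rewrite nth_zip ?size_map ?szE //= (nth_map (0, x)) //.
  have := congr1 (fun l => (nth (0, rj) l i).1) muE.
  by rewrite /= (nth_map (0, x)) // (nth_map (0, rj)) ?szE //= => <-; rewrite -surjective_pairing.
have zs0l z : z \in zs0 -> lab z.2 = reduct (lab x) pi (isP x) (flag a) sg z.1.2.
  move=> /(nthP ((0, rj), x))[i]; rewrite size_zip size_map szE minnn => ix <-.
  rewrite nth_zip ?size_map ?szE //= (nth_map (0, x)) //.
  have := congr1 (fun l => (nth (0, rj) l i).2) muE.
  by rewrite /= (nth_map (0, x)) // (nth_map (0, rj)) ?szE.
have good zs : perm_eq zs zs0 ->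
    [/\ perm_eq [seq (z.1.1, z.2) | z <- zs] (succ x) &
     step_at P (isP x) (lab x) [seq (z.1.1, lab z.2) | z <- zs] pi a sg (map fst zs)].
  move=> zsp; split; first by rewrite -zs0s; apply: perm_map.
  split=> //; split; first by apply: perm_trans xsa; rewrite -zs0x; apply: perm_map.
  rewrite -map_comp; apply/eq_in_map => z zz /=; congr pair; apply: zs0l.
  by rewrite -(perm_mem zsp).
have [bT|bF] := boolP (isP x).
  have [aE|aN] := pselect (a = alpha); last first.
    by exists (pi, a, sg, zs0); have [] := good zs0 (perm_refl _); split=> //; rewrite bT.
  (* One occurrence of the pair is moved to the front; further occurrences are treated like the
     other right-hand sides. *)
  have /mapP[z zz ze] : (pj, rj) \in map fst zs0.
    by rewrite zs0x (perm_mem xsa) aE.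
  have pz := perm_to_rem zz; exists (pi, a, sg, z :: rem z zs0).
  have [|? ?] := good (z :: rem z zs0); first by rewrite perm_sym.
  split=> //; last by rewrite bT.
  by move=> _ _; exists z.2, (rem z zs0); rewrite ze -surjective_pairing.
have [sr|nsr] := pselect (same_rule a beta); last first.
  by exists (pi, a, sg, zs0); have [] := good zs0 (perm_refl _); split=> //; rewrite (negbTE bF).
(* The ADP applied may be another one that equals [beta] up to annotations, so only the flattened
   right-hand sides can be aligned. *)
have /perm_map_ex[zs zsp zsE] : perm_eq [seq (y.1, flat y.2) | y <- rhs beta]
    [seq (z.1.1, flat z.1.2) | z <- zs0].
  rewrite perm_sym (map_comp (fun y => (y.1, flat y.2)) fst) zs0x.
  by apply: (flat_mdist_perm _ xsa); have [] := sr.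
exists (pi, a, sg, zs); have [? ?] := good zs zsp.
by split=> //; rewrite (negbTE bF).
Qed.

End NodeData.

(** * The eager cases: the outcome of the redex is drawn in advance *)

Definition linear_nonerasing := linear_adp beta /\ non_erasing beta.

(** The redex and its contractum with outcome [k] under one substitution. The final alternative
    keeps [th] common to both sides: its steps either have exactly one copy on each side, or do not
    exist. *)
Definition drawn k v w : Prop := exists th,
  [/\ v = subst th (lhs beta), w = subst th (flat (nth (0%R, rj) (rhs beta) k).2),
      flat v = v, (k < size (rhs beta))%N & linear_nonerasing \/ ANF P v].

Lemma drawn_redex k v w : drawn k v w -> ~ normal_form P v.
Proof. by move=> [th [vE _ vp _ _]]; apply: (redex_not_nf (sg := th) betaP); rewrite vp. Qed.

Lemma drawn_plain k v w : drawn k v w -> flat w = w.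
Proof.
move=> [th [vE -> vp kb _]]; have rkin := mem_nth (0, rj) kb.
apply: flat_subst; first exact: flat_flat.
move=> x; rewrite vars_flat => /(rhs_vars betaP rkin); apply: plain_subst_inv.
by rewrite -vE.
Qed.

Lemma drawn_init : linear_nonerasing \/ (ground rj_tau /\ ANF P rj_tau) ->
  forall sg k, (k < size (rhs beta))%N ->
  (forall y, vars rj_tau y -> normal_form P (sg y) /\ flat (sg y) = sg y) ->
  drawn k (subst sg rj_tau) (subst sg (subst sgb (flat (nth (0, rj) (rhs beta) k).2))).
Proof.
move=> cond sg k kb sgy; exists (fun x => subst sg (sgb x)); split=> //.
- by rewrite rj_tauE subst_comp.
- by rewrite subst_comp.
- by apply: flat_subst => // x /sgy[].
- by case: cond => [l|[gr an]]; [left|right; rewrite subst_ground].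
Qed.

Lemma drawn_step k v w p a sg : drawn k v w -> a \in P -> flag a = true ->
  subterm v p = Some (subst sg (lhs a)) ->
  (p = [::] /\ same_rule a beta) \/
  (p <> [::] /\ exists2 p', subterm w p' = Some (subst sg (lhs a)) &
     forall e, flat e = e -> drawn k (replace v p e) (replace w p' e)).
Proof.
move=> [th [vE wE vp kb cond]] aP am vs; have sp := plain_sub vp vs.
have vs' := vs; rewrite vE in vs'.
have [?|[p1 [p2 [x [pE p10 bp1 xp2]]]]] := beta_redex aP am vs'; [by left|right].
have p0 : p <> [::] by rewrite pE; case: (p1) p10.
split=> //; case: cond => [lin|an]; last first.
  (* An innermost redex admits no step properly inside. *)
  by case: (redex_not_nf (sg := sg) aP sp); exact: (anf_sub an p0 vs).
have [[llin rlin] ne] := lin; set rk := (nth _ _ k).2 in wE.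
have rkin : nth (0, rj) (rhs beta) k \in rhs beta by exact: mem_nth.
(* Non-erasure provides a copy of [x] in the contractum where the step can be repeated; linearity
   makes it the only copy. *)
have [p3 rp3] : vars (flat rk) x.
  by rewrite vars_flat; apply: (ne _ rkin); exists p1.
exists (p3 ++ p2).
  by rewrite wE subterm_cat (subterm_subst _ rp3).
move=> e ep; exists (fun y => if y == x then replace (th x) p2 e else th y); split=> //.
- by rewrite vE pE (replace_linear _ _ _ llin bp1).
- by rewrite wE (replace_linear _ _ _ (linear_flat (rlin _ rkin)) rp3).
- exact: plain_replace ep vs.
- by left.
Qed.

(* At the root the choice [k] made in advance is the outcome with index [k]. *)
Lemma drawn_root k v w a sg r : drawn k v w -> a \in P -> same_rule a beta ->
  v = subst sg (lhs a) -> flat r = flat (nth (0%R, rj) (rhs beta) k).2 ->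
  subst sg (flat r) = w.
Proof.
move=> [th [vE wE vp kb _]] aP [le _] vE' ->; rewrite wE; apply: subst_ext => x.
have rkin : nth (0, rj) (rhs beta) k \in rhs beta by exact: mem_nth.
rewrite vars_flat => /(rhs_vars betaP rkin).
by apply: subst_inj; rewrite -vE -le.
Qed.

Section EagerChoice.
Context (Q : eqType) (lab : Q -> term S V) (isP : Q -> bool) (succ : Q -> seq (R * Q))
  (sys : system (regular_step P) lab isP succ).
Hypothesis init_cond : linear_nonerasing \/ (ground rj_tau /\ ANF P rj_tau).
Context (d : Q -> position * adp R S V * (V -> term S V) * seq ((R * term S V) * Q)).
Hypothesis dP : forall x, succ x <> [::] -> node_data lab isP succ x (d x).

Definition pi_ x := (d x).1.1.1.
Definition adp_ x := (d x).1.1.2.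
Definition sg_ x := (d x).1.2.
Definition zs_ x := (d x).2.

Local Notation state := (Q * (position -> option nat))%type.
Local Notation bs := (enum_mset (rhs beta)).

Definition alpha_step x := isP x && (adp_ x == alpha).

(** The bound on [k] makes the branch selected in [eager_succ] an actual successor for every marking
    [c], not only for those that arise in the simulation. *)
Definition consumes x c :=
  ~~ isP x && (if c (pi_ x) is Some k then k < size (zs_ x) else false)%N.

Definition plain_succ x c : seq (R * state) :=
  [seq (z.1.1, (z.2, c)) | z <- zs_ x].

(* A step with [alpha] at an annotated position immediately draws the outcome [k]
   of the later step with [beta]; that step then follows the branch [k]. *)
Definition eager_succ (y : state) : seq (R * state) :=
  let: (x, c) := y in
  if nilp (succ x) then [::]
  else if alpha_step x then
    [seq (pj * (nth (0, rj) bs k).1,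
          ((head ((0, rj), x) (zs_ x)).2, setc c (pi_ x ++ tau) (Some k)))
      | k <- iota 0 (size bs)] ++ behead (plain_succ x c)
  else if consumes x c then
    [:: (1, ((nth ((0, rj), x) (zs_ x) (odflt 0%N (c (pi_ x)))).2, setc c (pi_ x) None))]
  else plain_succ x c.

Definition eager_isP (y : state) := isP y.1.

Lemma node_d_eq x : d x = (pi_ x, adp_ x, sg_ x, zs_ x).
Proof. by rewrite /pi_ /adp_ /sg_ /zs_; case: (d x) => [[[]]]. Qed.

Lemma node_dataP x : succ x <> [::] ->
  [/\ perm_eq [seq (z.1.1, z.2) | z <- zs_ x] (succ x),
      step_at P (isP x) (lab x) [seq (z.1.1, lab z.2) | z <- zs_ x] (pi_ x) (adp_ x)
        (sg_ x) (map fst (zs_ x)),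
      isP x || flag (adp_ x),
      isP x -> adp_ x = alpha -> (exists (y : Q) zs1, zs_ x = ((pj, rj), y) :: zs1)
    & ~~ isP x -> same_rule (adp_ x) beta ->
      [seq (z.1.1, flat z.1.2) | z <- zs_ x] = [seq (y.1, flat y.2) | y <- rhs beta]].
Proof. by move/dP; rewrite node_d_eq. Qed.

Lemma node_data_lab x z : succ x <> [::] -> z \in zs_ x ->
  lab z.2 = reduct (lab x) (pi_ x) (isP x) (flag (adp_ x)) (sg_ x) z.1.2.
Proof.
move=> xn zz; have [_ [_ _ _ _ [_ e]] _ _ _] := node_dataP xn.
have {e} : [seq lab z.2 | z <- zs_ x] =
  [seq reduct (lab x) (pi_ x) (isP x) (flag (adp_ x)) (sg_ x) z.1.2 | z <- zs_ x].
  by have := congr1 (map snd) e; rewrite -!map_comp.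
by move/eq_in_map/(_ z zz).
Qed.

Lemma zs_succ x z : succ x <> [::] -> z \in zs_ x -> (z.1.1, z.2) \in succ x.
Proof.
move=> xn zz; have [pe _ _ _ _] := node_dataP xn; rewrite -(perm_mem pe).
exact: (map_f (fun z => (z.1.1, z.2)) zz).
Qed.

Lemma zs_neq0 x : succ x <> [::] -> zs_ x <> [::].
Proof.
move=> xn z0; have [/perm_size pe _ _ _ _] := node_dataP xn.
by move: pe; rewrite z0 /=; case: (succ x) xn.
Qed.

Lemma beta_sum : \sum_(y <- rhs beta) y.1 = 1.
Proof. by have [_ _ [_ ->] _] := adpP betaP. Qed.

Lemma beta_rng y : y \in rhs beta -> 0 < y.1 <= 1.
Proof. by have [_ _ [rng _] _] := adpP betaP; exact: rng. Qed.

Lemma alpha_data x : succ x <> [::] -> alpha_step x ->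
  [/\ isP x = true, adp_ x = alpha &
      exists (y : Q) zs1, zs_ x = ((pj, rj), y) :: zs1].
Proof.
move=> xn /andP[xP /eqP xa]; have [_ _ _ h _] := node_dataP xn.
by split=> //; apply: h.
Qed.

Lemma eager_succ_mem x c y : succ x <> [::] -> y \in eager_succ (x, c) ->
  (exists r : R, (r, y.2.1) \in succ x) /\ 0 < y.1 <= 1.
Proof.
move=> xn; have [_ rng _] := sys.
have plain z : z \in zs_ x -> (exists r : R, (r, z.2) \in succ x) /\ 0 < z.1.1 <= 1.
  by move=> /(zs_succ xn) zx; split; [exists z.1.1|exact: rng zx].
rewrite /eager_succ; case: ifP => // _; case: ifP => [/(alpha_data xn)[_ _ [w [zs1 zE]]]|_].
  have hw : ((pj, rj), w) \in zs_ x by rewrite zE mem_head.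
  have [wx /andP[j0 j1]] := plain _ hw.
  rewrite mem_cat => /orP[/mapP[k + ->] /=|].
    rewrite mem_iota /= add0n => kb; have /andP[k0 k1] := beta_rng (mem_nth (0, rj) kb).
    by rewrite zE /=; split=> //; rewrite mulr_gt0 ?mulr_ile1 // ltW.
  rewrite /plain_succ zE /= => /mapP[z zz ->] /=.
  by apply: plain; rewrite zE inE zz orbT.
case: ifP => [|_ /mapP[z zz ->]]; last exact: plain.
rewrite /consumes => /andP[_]; case: (c _) => [k|] // kz; rewrite inE => /eqP -> /=.
by split; [have [] := plain _ (mem_nth ((0, rj), x) kz)|rewrite ltr01 lexx].
Qed.

Lemma eager_succ_nil x c : eager_succ (x, c) <> [::] -> succ x <> [::].
Proof. by rewrite /eager_succ => + x0; rewrite x0. Qed.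

Lemma eager_succ_neq0 x c : succ x <> [::] -> eager_succ (x, c) <> [::].
Proof.
move=> xn; have zn := zs_neq0 xn; rewrite /eager_succ; case: ifP => [/nilP//|_].
case: ifP => _.
  case E : (size bs) => [|n] //.
  by move/size0nil: E beta_sum => ->; rewrite big_nil => /esym/eqP; rewrite oner_eq0.
by case: ifP => // _; rewrite /plain_succ; case: (zs_ x) zn.
Qed.

Lemma eager_acc y : Acc (Rsucc eager_succ eager_isP) y.
Proof.
have [_ _ acc] := sys; case: y => x c; elim: (acc x) c => {}x _ IH c.
constructor=> -[x' c'] [nP [p px]].
have xn : succ x <> [::] by apply: (@eager_succ_nil x c) => e; rewrite e in px.
by apply: IH; split=> //; have [] := eager_succ_mem xn px.
Qed.

Lemma eager_rng y z : z \in eager_succ y -> 0 < z.1 <= 1.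
Proof.
case: y => x c zx; have xn : succ x <> [::] by apply: (@eager_succ_nil x c) => e; rewrite e in zx.
by have [] := eager_succ_mem xn zx.
Qed.

Definition eager_sim (y : state) u := psim drawn y.2 (lab y.1) u.

Lemma eager_sim_step y u : eager_sim y u -> eager_succ y <> [::] ->
  exists k s, dets (tree_step P'') k u s /\
    ((exists b zs, matches (tree_step P'') eager_isP eager_succ eager_sim y b s zs)
     \/ (exists y', [/\ eager_succ y = [:: (1, y')], ~~ eager_isP y & eager_sim y' s])).
Proof.
case: y => x c; rewrite /eager_sim /= => xu /eager_succ_nil xn; exists 0%N, u; split=> //.
have [_ st ba xal xbe] := node_dataP xn; have [aP anf bpi fl [xsa _]] := st.
have [s ts sE] : exists2 s, subterm (lab x) (pi_ x) = Some s
    & flat s = subst (sg_ x) (lhs (adp_ x)).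
  by case: (subterm _ _) fl => //= s [sE]; exists s.
have nx : nilp (succ x) = false by apply/nilP.
(* Does the step take place at or below a waiting redex? *)
have [[q0 [opi co]]|np] := pselect (exists o, prefix o (pi_ x) /\ c o <> None).
  case cok : (c q0) co => [k|] // _; have [v [w [xo uo pe ab be]]] := psim_pend xu cok.
  case/prefixP: opi => p piE; have vp : flat v = v by case: pe => th [].
  have vs : subterm v p = Some s by move: ts; rewrite piE subterm_cat xo.
  have sp := plain_sub vp vs; rewrite sp in sE.
  (* Waiting redexes carry no annotations, so no P-step happens inside them. *)
  have nP : isP x = false.
    by apply/negP => /bpi; rewrite piE (pos_ann_cat _ xo); exact: plain_pos_ann.
  have am : flag (adp_ x) = true by rewrite nP in ba.
  have nal : alpha_step x = false by rewrite /alpha_step nP.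
  rewrite sE in vs; have plainE z : z \in zs_ x ->
      flat (subst (sg_ x) (flat z.1.2)) = subst (sg_ x) (flat z.1.2).
    move=> zz; apply: (subst_plain fl); rewrite ?flat_flat // vars_flat.
    by apply: (rhs_vars aP); rewrite -(perm_mem xsa); apply: map_f.
  have [[p0 sr]|[p0 [p' wp' rep]]] := drawn_step pe aP am vs.
    (* The root step was anticipated by the draw: the state follows branch [k], the term stays as it
       is, and the mark is cleared. *)
    right; rewrite p0 cats0 in piE; subst p.
    have zsE := xbe (negbT nP) sr.
    have kb : (k < size bs)%N by case: pe => th [].
    have szE : size (zs_ x) = size bs by have := congr1 size zsE; rewrite !size_map.
    have cons : consumes x c by rewrite /consumes nP piE cok /= szE.
    exists ((nth ((0, rj), x) (zs_ x) k).2, setc c (pi_ x) None); split.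
    - by rewrite /eager_succ nx nal cons piE cok.
    - by rewrite /eager_isP nP.
    have kz : nth ((0, rj), x) (zs_ x) k \in zs_ x by rewrite mem_nth // szE.
    rewrite /= (node_data_lab xn kz) nP reductE am /=.
    rewrite (drawn_root (k := k) (v := v) (w := w) pe aP sr).
    - rewrite -graft_clear piE // -(replace_id uo).
      exact: psim_replace xu xo ab (psim_refl _ _).
    - by move: vs; rewrite subterm_nil => -[].
    - have := congr1 (fun l => (nth (0, rj) l k).2) zsE.
      by rewrite /= (nth_map ((0, rj), x)) ?szE // (nth_map (0, rj)).
  (* A step inside the substitution is repeated at the corresponding position of the contractum. *)
  left; exists false, [seq ((z.1.1, (z.2, c)), replace u (q0 ++ p') (subst (sg_ x) (flat z.1.2)))
    | z <- zs_ x].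
  have cpi : c (pi_ x) = None by rewrite piE be.
  split.
  - by rewrite -map_comp /eager_succ nx nal /consumes cpi andbF.
  - rewrite -map_comp (_ : map _ _ = [seq (y.1, replace u (q0 ++ p') (subst (sg_ x) (flat y.2)))
      | y <- map fst (zs_ x)]); last by rewrite -map_comp.
    have up : subterm u (q0 ++ p') = Some s by rewrite subterm_cat uo /= wp' sE.
    apply: (reduct_step aP am anf up) => //; first by rewrite sp.
    by rewrite (pos_ann_cat _ uo); apply: plain_pos_ann; exact: drawn_plain pe.
  - by rewrite /eager_isP /= nP.
  - move=> _ /mapP[z zz ->] /=; rewrite (node_data_lab xn zz) nP reductE am /= piE.
    rewrite (replace_cat _ _ xo) (replace_cat _ _ uo).
    have := psim_replace xu xo ab (psim_point (rep _ (plainE z zz))).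
    by rewrite (graft_keep cok be).
have np' q : prefix q (pi_ x) -> c q = None.
  by move=> qpi; case E : (c q) => [k|] //; case: np; exists q; rewrite E.
left; have [al|nal] := boolP (alpha_step x).
  have [xP xa [w [zs1 zE]]] := alpha_data xn al.
  rewrite xP xa zE in st; have [g1 g2 g3] := mimic_alpha drawn_redex (drawn_init init_cond) xu st np'.
  exists true, ([seq ((pj * (nth (0, rj) bs k).1, (w, setc c (pi_ x ++ tau) (Some k))),
     reduct u (pi_ x) true (flag alpha) (sg_ x) (rewr (nth (0, rj) bs k))) | k <- iota 0 (size bs)]
   ++ [seq ((z.1.1, (z.2, c)), reduct u (pi_ x) true (flag alpha) (sg_ x) z.1.2) | z <- zs1]).
  split=> //.
  - by rewrite map_cat -!map_comp /eager_succ nx al /plain_succ zE.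
  - move: g1; congr (tree_step _ _ _ _); rewrite map_cat -!map_comp; congr (_ ++ _).
    by rewrite -[in LHS](mkseq_nth (0, rj) bs) /mkseq -map_comp.
  - move=> z; rewrite mem_cat => /orP[/mapP[k + ->]|/mapP[z' zz ->]] /=.
      rewrite mem_iota /= add0n => /g2; rewrite (@node_data_lab x ((pj, rj), w)) ?zE ?mem_head //.
      by rewrite xP xa.
    rewrite (@node_data_lab x z') ?zE ?inE ?zz ?orbT // xP xa; apply: g3.
    exact: (map_f fst zz).
have nba : ~ (isP x /\ adp_ x = alpha).
  by move=> [xP xa]; move: nal; rewrite /alpha_step xP xa eqxx.
have [g1 g2] := mimic drawn_redex xu st ba np' nba.
exists (isP x), [seq ((z.1.1, (z.2, c)), reduct u (pi_ x) (isP x) (flag (adp_ x)) (sg_ x) z.1.2)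
  | z <- zs_ x]; split=> //.
- by rewrite -map_comp /eager_succ nx (negbTE nal) /consumes np' ?prefix_refl ?andbF.
- by move: g1; rewrite -!map_comp.
- move=> _ /mapP[z zz ->] /=; rewrite (node_data_lab xn zz); apply: g2.
  exact: (map_f fst zz).
Qed.

Local Notation weight k := (nth (0%R, rj) bs k).1.

Lemma weight_sum : \sum_(k <- iota 0 (size bs)) weight k = 1.
Proof. by rewrite -beta_sum (big_nth (0, rj)) /index_iota subn0. Qed.

Definition pending x p := exists k v w, subterm (lab x) p = Some v /\ drawn k v w.

(** A step above the waiting redex would not be innermost. A step inside contracts it or leaves it
    waiting, and a parallel step leaves it untouched; P-steps are parallel, since the redex carries
    no annotations. *)
Lemma pending_step x p : succ x <> [::] -> pending x p ->
  [/\ pi_ x = p, ~~ isP x & same_rule (adp_ x) beta] \/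
  [/\ pi_ x <> p, forall z, z \in zs_ x -> pending z.2 p & isP x -> par p (pi_ x)].
Proof.
move=> xn [k [v [w [xp pe]]]].
have [_ st ba _ _] := node_dataP xn; have [aP anf bpi fl [xsa _]] := st.
have [s ts sE] : exists2 s, subterm (lab x) (pi_ x) = Some s
    & flat s = subst (sg_ x) (lhs (adp_ x)).
  by case: (subterm _ (pi_ x)) fl => //= s [sE]; exists s.
have vp : flat v = v by case: pe => th [].
have [pp|[[r piE]|[i [r pE]]]] := pos_cases p (pi_ x).
- right; split=> //.
    by move=> e; move: pp; rewrite e /par prefix_refl.
  move=> z zz; exists k, v, w; split=> //; rewrite (node_data_lab xn zz) reductE.
  have pp' : par (pi_ x) p by rewrite par_sym.
  case: (flag _); rewrite /= ?subterm_flat_above ?subterm_replace_par //.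
  by case/andP: pp => ->.
- have vs : subterm v r = Some s by move: ts; rewrite piE subterm_cat xp.
  have sp := plain_sub vp vs; rewrite sp in sE; rewrite sE in vs.
  have nP : isP x = false.
    by apply/negP => /bpi; rewrite piE (pos_ann_cat _ xp); exact: plain_pos_ann.
  have am : flag (adp_ x) = true by rewrite nP in ba.
  have [[r0 sr]|[r0 [p' wp' rep]]] := drawn_step pe aP am vs.
    by left; rewrite piE r0 cats0 nP.
  right; split; rewrite ?nP //.
    by rewrite piE -[in X in _ <> X](cats0 p) => /eqP; rewrite eqseq_cat // eqxx /= => /eqP.
  move=> z zz; rewrite /pending (node_data_lab xn zz) nP reductE am /= piE.
  rewrite (subterm_replace_above _ _ xp).
  have ep : flat (subst (sg_ x) (flat z.1.2)) = subst (sg_ x) (flat z.1.2).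
    apply: (subst_plain fl); rewrite ?flat_flat // vars_flat.
    by apply: (rhs_vars aP); rewrite -(perm_mem xsa); apply: map_f.
  by exists k; do 2!eexists; split; [reflexivity|exact: (rep _ ep)].
- case: (drawn_redex pe); apply/nf_flat.
  have sv : subterm (flat s) (i :: r) = Some (flat v).
    by rewrite subterm_flat; move: xp; rewrite pE subterm_cat ts /= => ->.
  by rewrite sE in sv; apply: (anf_sub anf) sv.
Qed.

Lemma pending_alpha x z : succ x <> [::] -> isP x -> adp_ x = alpha -> z \in zs_ x ->
  z.1 = (pj, rj) -> pending z.2 (pi_ x ++ tau).
Proof.
move=> xn xP xa zz zE; rewrite /pending (node_data_lab xn zz) zE xP reductE /=.
have [_ st _ _ _] := node_dataP xn; have [aP anf bpi fl [xsa _]] := st.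
have [s ts sE] : exists2 s, subterm (lab x) (pi_ x) = Some s
    & flat s = subst (sg_ x) (lhs (adp_ x)).
  by case: (subterm _ (pi_ x)) fl => //= s [sE]; exists s.
(* Any outcome serves as witness; there is one because the probabilities of [beta] sum to 1. *)
exists 0%N, (subst (sg_ x) rj_tau); eexists; split; last first.
  apply: (drawn_init init_cond).
    rewrite lt0n; apply/eqP => /size0nil b0; have := beta_sum.
    by rewrite b0 big_nil => /esym/eqP; rewrite oner_eq0.
  move=> y yt; have yl : vars (lhs (adp_ x)) y.
    by rewrite xa; apply: (rhs_vars alphaP rj_in); apply: (vars_sub rj_tau_def).
  split; first exact: (lhs_vars_nf aP anf yl).
  by apply: (plain_subst_inv _ yl); rewrite -sE flat_flat.
case: (flag _) => /=.
  by rewrite (subterm_replace _ _ ts) (subterm_subst _ rj_tau_def).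
rewrite subterm_flat_above ?(subterm_replace _ _ ts) ?(subterm_subst _ rj_tau_def) //.
case: tau => [|j q]; first by rewrite cats0 eqxx orbT.
apply/orP; left; apply/negP => /prefixP[r /(congr1 size)/eqP].
by rewrite !size_cat /= -addnA -[eqbLHS]addn0 eqn_add2l.
Qed.

Lemma setc_comm c p q m n : p <> q -> setc (setc c p m) q n = setc (setc c q n) p m.
Proof.
move=> pq; apply: funext => r; rewrite /setc; case: (eqVneq r q) => [->|//].
by case: eqP => // e; case: pq.
Qed.

Lemma setc_none c p m : c p = None -> setc (setc c p m) p None = c.
Proof. by move=> cp; apply: funext => r; rewrite /setc; case: eqP => // ->. Qed.

Definition shift p k (y : R * state) : R * state :=
  (y.1, (y.2.1, setc y.2.2 p (Some k))).

Lemma eager_succ_shift x c p k : succ x <> [::] -> pi_ x <> p ->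
  (alpha_step x -> pi_ x ++ tau <> p) ->
  eager_succ (x, setc c p (Some k)) = map (shift p k) (eager_succ (x, c)).
Proof.
move=> xn pp ap; rewrite /eager_succ; case: ifP => // _.
have cE : setc c p (Some k) (pi_ x) = c (pi_ x) by rewrite /setc; case: eqP.
case: ifP => [al|_].
  rewrite map_cat -map_comp /plain_succ -behead_map -map_comp; congr (_ ++ _).
  by apply: eq_map => j; rewrite /shift /= setc_comm //; apply/nesym/ap.
rewrite /consumes cE; case: ifP => _; last by rewrite /plain_succ -map_comp.
by rewrite /shift /= setc_comm //; apply/nesym.
Qed.

Lemma eager_succ_zs x c y : succ x <> [::] -> y \in eager_succ (x, c) ->
  (exists2 z, z \in zs_ x & z.2 = y.2.1) /\
  (forall p, c p = None -> (alpha_step x -> pi_ x ++ tau <> p) -> y.2.2 p = None).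
Proof.
move=> xn; rewrite /eager_succ; case: ifP => // _; case: ifP => [al|_].
  have [_ _ [w [zs1 zE]]] := alpha_data xn al.
  rewrite mem_cat => /orP[/mapP[k _ ->]|] /=.
    split; first by exists ((pj, rj), w); rewrite zE ?mem_head.
    by move=> p cp /(_ isT) np; rewrite /setc; case: eqP => // e; case: np.
  rewrite /plain_succ zE /= => /mapP[z zz ->]; split=> //.
  by exists z; rewrite // inE zz orbT.
case: ifP => [|_ /mapP[z zz ->]]; last by split=> //; exists z.
rewrite /consumes => /andP[_]; case: (c _) => [k|] // kz; rewrite inE => /eqP -> /=.
split; first by exists (nth ((0, rj), x) (zs_ x) k); rewrite ?mem_nth.
by move=> p cp _; rewrite /setc; case: eqP.
Qed.

(** Drawing in advance preserves the average at every finite depth, by induction along the steps. A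
    step that does not contract the redex commutes with setting the mark at [p]; where the run
    stops, the average is over equal values. *)
Lemma eager_mass_split n x c p : c p = None -> pending x p ->
  mass eager_succ n (x, c) =
  \sum_(k <- iota 0 (size bs)) weight k * mass eager_succ n (x, setc c p (Some k)).
Proof.
elim: n x c p => [|n IH] x c p cp xp; have [x0|xn] := pselect (succ x = [::]).
- have l13 c' : mass eager_succ 0 (x, c') = 1 by rewrite mass_leaf // /eager_succ x0.
  by rewrite l13; under eq_bigr do rewrite l13 mulr1; rewrite weight_sum.
- have n13 c' : mass eager_succ 0 (x, c') = 0.
    by rewrite /mass; case: nilP => // e; case: (@eager_succ_neq0 x c' xn).
  by rewrite n13; under eq_bigr do rewrite n13 mulr0; rewrite big1.
- have l13 c' : mass eager_succ n.+1 (x, c') = 1 by rewrite mass_leaf // /eager_succ x0.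
  by rewrite l13; under eq_bigr do rewrite l13 mulr1; rewrite weight_sum.
have nx : nilp (succ x) = false by apply/nilP.
have n0 c' : eager_succ (x, c') <> [::] by exact: eager_succ_neq0.
rewrite massS //; under [RHS]eq_bigr do rewrite massS //.
have [[piE nP sr]|[npi pz pp]] := pending_step xn xp.
  (* The redex is contracted here. Without a mark the step branches as [beta] does; with mark [k] it
     follows branch [k] alone. *)
  have [_ _ _ _ /(_ nP sr) zsE] := node_dataP xn.
  have szE : size (zs_ x) = size bs by have := congr1 size zsE; rewrite !size_map.
  have nal : alpha_step x = false by rewrite /alpha_step (negbTE nP).
  rewrite {1}/eager_succ nx nal /consumes piE cp andbF /plain_succ big_map.
  rewrite (big_nth ((0, rj), x)) /index_iota subn0 szE big_seq [RHS]big_seq.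
  apply: eq_bigr => k; rewrite mem_iota /= add0n => kb.
  have cE : setc c p (Some k) p = Some k by rewrite /setc eqxx.
  rewrite /eager_succ nx nal /consumes piE nP cE szE kb /= big_seq1 /= mul1r setc_none //; congr (_ * _).
  have := congr1 (fun l => (nth (0, rj) l k).1) zsE.
  by rewrite /= (nth_map ((0, rj), x)) ?szE // (nth_map (0, rj)).
(* A P-step is parallel to the waiting redex, so the mark it sets cannot fall on [p]. *)
have ap : alpha_step x -> pi_ x ++ tau <> p.
  by case/andP=> /pp + _ => /[swap] <-; rewrite /par prefix_prefix andbF.
under [RHS]eq_bigr do rewrite eager_succ_shift // big_map mulr_sumr.
rewrite exchange_big /= big_seq [RHS]big_seq; apply: eq_bigr => y yx.
have [[z zz zE] cy] := eager_succ_zs xn yx.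
have -> : mass eager_succ n y.2 = mass eager_succ n (y.2.1, y.2.2).
  by rewrite -surjective_pairing.
rewrite (IH y.2.1 y.2.2 p); last 2 first.
- exact: cy.
- by rewrite -zE; apply: pz.
by rewrite mulr_sumr; apply: eq_bigr => k _; rewrite mulrCA.
Qed.

(** The masses agree exactly, depth by depth, because following a drawn branch remains a transition
    of its own. *)
Lemma eager_mass n x : mass eager_succ n (x, fun=> None) = mass succ n x.
Proof.
elim: n x => [|n IH] x; have [x0|xn] := pselect (succ x = [::]).
- by rewrite !mass_leaf // /eager_succ x0.
- rewrite /mass; case: nilP => [e|_]; first by case: (@eager_succ_neq0 x (fun=> None) xn).
  by case: nilP.
- by rewrite !mass_leaf // /eager_succ x0.
have nx : nilp (succ x) = false by apply/nilP.
rewrite !massS //; last exact: eager_succ_neq0.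
have [pe _ _ _ _] := node_dataP xn; rewrite -(perm_big _ pe) big_map /=.
rewrite /eager_succ nx; case: ifP => [al|_]; last first.
  rewrite /consumes andbF /plain_succ big_map.
  by apply: eq_bigr => z _; rewrite IH.
have [xP xa [w [zs1 zE]]] := alpha_data xn al.
rewrite big_cat /= big_map /plain_succ zE /= big_cons big_map /=; congr (_ + _).
  under eq_bigr do rewrite -mulrA.
  rewrite -mulr_sumr -eager_mass_split ?IH //.
  by apply: (@pending_alpha x ((pj, rj), w)); rewrite ?zE ?mem_head.
by apply: eq_bigr => z _; rewrite IH.
Qed.

Lemma eager_system x0 : exists (Q' : eqType) (lab' : Q' -> term S V) isP'
    (succ' : Q' -> seq (R * Q')) x',
  system (tree_step P'') lab' isP' succ' /\
  forall b, (forall n, mass succ n x0 <= b) -> forall n, mass succ' n x' <= b.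
Proof.
have x0s : eager_sim (x0, fun=> None) (lab x0) by exact: psim_refl.
have [Q' [lab' [isP' [succ' [x' [sys' mb]]]]]] := simulation eager_rng eager_acc eager_sim_step x0s.
exists Q', lab', isP', succ', x'; split=> // b bP; apply: mb => n.
by rewrite eager_mass.
Qed.

End EagerChoice.

(** * The deterministic case: evaluation of the contractum is postponed *)

Section Deterministic.
Hypothesis det : forall a, usable P rj_tau a -> deterministic a.

Lemma usable_in t a : usable P t a -> a \in P /\ flag a = true.
Proof. by elim=> [g ts {}a []|//|//]. Qed.

Lemma usable_trans t a x a' : usable P t a -> x \in rhs a ->
  usable P (flat x.2) a' -> usable P t a'.
Proof.
move=> ta xa xa'; elim: ta xa => {t a} [g ts a ga|g ts i a _ IH|g ts b y a gb yb _ IH] xa.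
- exact: usable_rhs ga xa xa'.
- exact: (usable_arg (IH xa)).
- exact: usable_rhs gb yb (IH xa).
Qed.

(** Restricted to usable rules, for which non-overlappingness gives confluence. *)
Definition dstep s s' : Prop := exists p a sg r,
  [/\ usable P rj_tau a, flat s = s, subterm s p = Some (subst sg (lhs a)),
      ANF P (subst sg (lhs a))
    & rhs a = [mset (1, r)]%mset /\ s' = replace s p (subst sg (flat r))].

Fixpoint nsteps n s t : Prop :=
  if n is m.+1 then exists2 u, dstep s u & nsteps m u t else s = t.

Lemma det_rhs_vars a r : usable P rj_tau a -> rhs a = [mset (1, r)]%mset ->
  vars r `<=` vars (lhs a).
Proof.
move=> ua ra; have [aP _] := usable_in ua.
by apply: (rhs_vars aP (x := (1, r))); rewrite ra in_mset1.
Qed.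

Lemma det_flat a sg s p r : usable P rj_tau a -> rhs a = [mset (1, r)]%mset ->
  flat s = s -> subterm s p = Some (subst sg (lhs a)) ->
  flat (subst sg (flat r)) = subst sg (flat r).
Proof.
move=> ua ra sp ss; apply: (@subst_plain _ _ sg (lhs a) s p); rewrite ?flat_flat //.
  by rewrite ss /= (plain_sub sp ss).
by rewrite vars_flat; exact: det_rhs_vars.
Qed.

Lemma dstep_plain s s' : dstep s s' -> flat s' = s'.
Proof.
move=> [p [a [sg [r [ua sp ss _ [ra ->]]]]]].
exact: plain_replace sp (det_flat ua ra sp ss) ss.
Qed.

Lemma nsteps_plain n s s' : flat s = s -> nsteps n s s' -> flat s' = s'.
Proof.
elim: n s => [|n IH] s sp /=; first by move=> <-.
by move=> [u /dstep_plain up us]; apply: IH us.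
Qed.

Lemma nsteps_cat m n s t u : nsteps m s t -> nsteps n t u -> nsteps (m + n) s u.
Proof.
elim: m s => [|m IH] s /=; first by move=> ->.
by move=> [v sv vt] tu; exists v => //; apply: IH.
Qed.

Lemma redex_sub_anf a a' sg sg' p : a \in P ->
  flat (subst sg (lhs a)) = subst sg (lhs a) ->
  ANF P (subst sg' (lhs a')) -> p <> [::] ->
  subterm (subst sg' (lhs a')) p = Some (subst sg (lhs a)) -> False.
Proof.
by move=> aP ap anf p0 sub; apply: (redex_not_nf (sg := sg) aP ap); exact: anf_sub anf p0 sub.
Qed.

Lemma same_det a a' r r' : same_rule a a' -> rhs a = [mset (1, r)]%mset ->
  rhs a' = [mset (1, r')]%mset -> flat r = flat r'.
Proof.
move=> [_]; rewrite /flat_mdist => e ra ra'.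
have : (1, flat r) \in mset_map (fun x : R * term S V => (x.1, flat x.2)) (rhs a).
  by rewrite (perm_mem (perm_eq_seq_mset _)); apply/mapP; exists (1, r); rewrite // ra in_mset1.
by rewrite e => /mset_map_mem[x]; rewrite ra' in_mset1 => /eqP -> [].
Qed.

(** Parallel steps commute, nested ones cannot both be innermost, and at a common position the two
    rules agree up to annotations. *)
Lemma dstep_diamond s t u : dstep s t -> dstep s u ->
  t = u \/ exists2 v, dstep t v & dstep u v.
Proof.
move=> sT sU; have tp := dstep_plain sT; have up := dstep_plain sU.
case: sT => p [a [sg [r [ua sp sa anf [ra tE]]]]].
case: sU => p' [a' [sg' [r' [ua' _ sa' anf' [ra' uE]]]]].
have [aP _] := usable_in ua; have [aP' _] := usable_in ua'.
have ap := plain_sub sp sa; have ap' := plain_sub sp sa'.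
have [pp|[[q pE]|[i [q pE]]]] := pos_cases p p'.
- right; exists (replace t p' (subst sg' (flat r'))).
    exists p', a', sg', r'; split=> //.
    by rewrite tE subterm_replace_par.
  exists p, a, sg, r; split=> //.
    by rewrite uE subterm_replace_par // par_sym.
  by split=> //; rewrite tE uE; apply: replace_par pp sa sa'.
- move: (sa'); rewrite pE subterm_cat sa /= => sub.
  have [q0|q0] := pselect (q = [::]); last by case: (redex_sub_anf aP' ap' anf q0 sub).
  left; rewrite tE uE pE q0 cats0; congr replace.
  move: sub; rewrite q0 subterm_nil => -[e].
  have [f lf] := lhs_root aP'.
  have [|||sr _] := @overlap_root a a' sg sg' [::] (lhs a') ua ua'; rewrite ?subterm_nil ?lf //.
  rewrite (same_det sr ra ra'); apply: subst_ext => x.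
  rewrite vars_flat => /(det_rhs_vars ua' ra').
  by have [le _] := sr; apply: subst_inj; rewrite -e le.
- move: (sa); rewrite pE subterm_cat sa' /= => sub.
  by case: (redex_sub_anf aP ap anf' _ sub).
Qed.

Lemma dstep_not_nf s s' : dstep s s' -> ~ normal_form P s.
Proof.
move=> [p [a [sg [r [ua sp ss _ _]]]]] ns; have [aP _] := usable_in ua.
by apply: (redex_not_nf (sg := sg) aP (plain_sub sp ss)); apply: nf_sub ns ss.
Qed.

(** As divergent steps are joined by exactly one step on each side, every step brings the normal
    form nearer by exactly one. *)
Lemma nsteps_strip n s s' u : nsteps n s u -> normal_form P u -> dstep s s' ->
  (0 < n)%N /\ nsteps n.-1 s' u.
Proof.
move=> + nu; elim: n s s' => [|n IH] s s' /=.
  by move=> -> /dstep_not_nf.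
move=> [s1 ss1 s1u] ss'; split=> //.
have [<- //|[v s1v s'v]] := dstep_diamond ss1 ss'.
by have [n0 vu] := IH _ _ s1u s1v; case: n n0 {IH s1u} vu => //= n _ vu; exists v.
Qed.

Lemma nsteps_strips n k s s' u : nsteps n s u -> normal_form P u -> nsteps k s s' ->
  (k <= n)%N /\ nsteps (n - k) s' u.
Proof.
move=> + nu; elim: k n s => [|k IH] n s su /=; first by move=> <-; rewrite subn0.
move=> [s1 ss1 s1s']; have [n0 s1u] := nsteps_strip su nu ss1.
by case: n n0 su s1u => // n _ _ s1u; have := IH _ _ s1u s1s'; rewrite ltnS subSS.
Qed.

Lemma dstep_ctx t p v v' : flat t = t -> subterm t p = Some v -> dstep v v' ->
  dstep t (replace t p v').
Proof.
move=> tp tv [q [a [sg [r [ua vp va anf [ra ->]]]]]].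
exists (p ++ q), a, sg, r; split=> //; first by rewrite subterm_cat tv.
by split=> //; rewrite (replace_cat _ _ tv).
Qed.

Lemma nsteps_ctx n t p v v' : flat t = t -> subterm t p = Some v -> nsteps n v v' ->
  nsteps n t (replace t p v').
Proof.
elim: n t v => [|n IH] t v tp tv /=; first by move=> <-; rewrite (replace_id tv).
move=> [v1 vv1 v1v']; have st := dstep_ctx tp tv vv1.
exists (replace t p v1) => //; rewrite -(replace_replace v1 v' tv).
by apply: (IH _ v1) => //; [exact: dstep_plain st|exact: subterm_replace_eq tv].
Qed.

Lemma nsteps_args (g : sym S) (ts us : 'I_(arity g) -> term S V)
    (k : 'I_(arity g) -> nat) : flat (App g ts) = App g ts ->
  (forall i, nsteps (k i) (ts i) (us i)) ->
  nsteps (\sum_i k i) (App g ts) (App g us).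
Proof.
move=> gp st.
suff H (l : seq 'I_(arity g)) : uniq l -> nsteps (\sum_(i <- l) k i) (App g ts)
    (App g (fun j => if j \in l then us j else ts j)).
  have := H _ (index_enum_uniq 'I_(arity g)).
  by congr (nsteps _ _ _); apply: eq_App => i; rewrite mem_index_enum.
elim: l => [_|i l IH /= /andP[il ul]]; first by rewrite big_nil.
rewrite big_cons addnC; set f := fun j => if j \in l then us j else ts j.
have fi : subterm (App g f) [:: val i] = Some (ts i).
  by rewrite subterm_App subterm_nil /f (negbTE il).
have := IH ul => lst; apply: (nsteps_cat lst).
have := nsteps_ctx (nsteps_plain gp lst) fi (st i).
congr (nsteps _ _ _); rewrite replace_App; apply: eq_App => j.
by rewrite inE; case: eqVneq => [->|_] //=; rewrite replace_nil.
Qed.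

(** Every copy of [x] makes the step once. The positivity of [k] makes the induction of
    [rewrite_first] decrease. *)
Lemma nsteps_subst (th : V -> term S V) x y l : flat (subst th l) = subst th l ->
  dstep (th x) y -> exists k,
  nsteps k (subst th l) (subst (fun z => if z == x then y else th z) l) /\
  (vars l x -> (0 < k)%N).
Proof.
move=> + xy; elim: l => [z|g ts IH] lp /=.
  have [->|zx] := eqVneq z x; first by exists 1%N; split=> //=; exists y.
  by exists 0%N; split=> // -[[|//]] [e]; rewrite e eqxx in zx.
have tp i : flat (subst th (ts i)) = subst th (ts i).
  by apply: (plain_sub lp (p := [:: val i])); rewrite [subst _ _]/= subterm_App subterm_nil.
have [k kP] := choice (fun i => IH i (tp i)).
exists (\sum_i k i)%N; split; first by apply: nsteps_args => // i; have [] := kP i.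
move=> /vars_App[i xi]; have [_ /(_ xi) ki] := kP i.
by rewrite (bigD1 i) //= ltn_addr.
Qed.

Context (rb : term S V) (rbE : rhs beta = [mset (1, rb)]%mset).

(* Rewriting the outermost redex first does not change the normal form: steps
   below a variable are performed on all copies, using confluence. *)
Lemma rewrite_first n (th : V -> term S V) u : nsteps n (subst th (lhs beta)) u ->
  flat (subst th (lhs beta)) = subst th (lhs beta) -> normal_form P u ->
  exists m, nsteps m (subst th (flat rb)) u.
Proof.
elim: n {-2}n (leqnn n) th => [|N IH] n nN th st lp nu.
  move: nN st; rewrite leqn0 => /eqP -> /= e.
  by case: (redex_not_nf (sg := th) betaP lp); rewrite e.
case: n nN st => [|n] nN st.
  by case: (redex_not_nf (sg := th) betaP lp); rewrite [X in normal_form _ X]st.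
have [s1 ss1 s1u] := st; have [p [a [sg [r [ua _ sa anf [ra s1E]]]]]] := ss1.
have [aP am] := usable_in ua.
have [[p0 sr]|[p1 [p2 [x [pE p10 bp1 xp2]]]]] := beta_redex aP am sa.
  exists n; move: s1u; rewrite s1E p0 replace_nil (same_det sr ra rbE).
  congr (nsteps _ _ _); apply: subst_ext => x.
  rewrite vars_flat => /(det_rhs_vars beta_usable rbE).
  by move: sa; rewrite p0 subterm_nil => -[e]; have [le _] := sr;
    apply: subst_inj; rewrite e le.
have xl : vars (lhs beta) x by exists p1.
have xp : flat (th x) = th x := plain_subst_inv lp xl.
pose y := replace (th x) p2 (subst sg (flat r)).
have xy : dstep (th x) y by exists p2, a, sg, r.
pose th' z := if z == x then y else th z.
(* The given step affects one copy of [th x]. Making it in all copies uses up [k] steps of the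
   evaluation, by confluence, and leads to an instance of [lhs beta] again. *)
have [k [kst k0]] := nsteps_subst lp xy.
have [kn st'] := nsteps_strips st nu kst.
have [||m mst] := IH (n.+1 - k)%N _ th' st' _ nu.
- by have := k0 xl; case: k {kst k0 st'} kn => // k _ _; rewrite subSS (leq_trans (leq_subr _ _)).
- exact: nsteps_plain lp kst.
have rp : flat (subst th (flat rb)) = subst th (flat rb).
  apply: flat_subst; first exact: flat_flat.
  move=> z; rewrite vars_flat => /(det_rhs_vars beta_usable rbE).
  exact: plain_subst_inv lp z.
(* The contractum follows the same change of substitution, in a number of steps of its own, possibly
   zero. *)
have [k' [k'st _]] := nsteps_subst rp xy.
by exists (k' + m)%N; apply: nsteps_cat k'st mst.
Qed.

(** Invariant that confines the evaluation of the redex to usable rules; the normal subterms are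
    those contributed by substitutions. *)
Definition all_usable v : Prop := forall p g ts, subterm v p = Some (App g ts) ->
  normal_form P (App g ts) \/ forall a, rules P g a -> usable P rj_tau a.

(** While [v] is evaluated, [w] stays fixed and only has to be able to reach whatever normal form
    [v] can reach. If [v] never becomes normal, [w] is never touched. *)
Definition deferred (_ : nat) v w : Prop :=
  [/\ flat v = v, flat w = w, all_usable v, ~ normal_form P v
    & forall n u, nsteps n v u -> normal_form P u -> exists m, nsteps m w u].

(** New subterms stem from the right-hand side of a usable rule, whose own rules are usable by
    transitivity, or from the substitution, which is normal because the step is innermost. *)
Lemma all_usable_step v p a sg : flat v = v -> all_usable v -> a \in P -> flag a = true ->
  subterm v p = Some (subst sg (lhs a)) -> ANF P (subst sg (lhs a)) ->
  exists r, [/\ rhs a = [mset (1, r)]%mset, dstep v (replace v p (subst sg (flat r)))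
              & all_usable (replace v p (subst sg (flat r)))].
Proof.
move=> vp au aP am va anf; have [f lf] := lhs_root aP.
have ap := plain_sub vp va; have nn := redex_not_nf (sg := sg) aP ap.
have ua : usable P rj_tau a.
  have := root_subst sg lf; case E : (subst sg (lhs a)) => [//|g ts] /= [gf].
  have [nf|h] := au p g ts (etrans va (congr1 Some E)); first by rewrite E in nn.
  by apply: h; rewrite gf.
have [_ [r ra]] := det ua; exists r; split=> //; first by exists p, a, sg, r.
move=> q g ts; have [pq|[[q' qE]|[i [q' pE]]]] := pos_cases p q.
- by rewrite subterm_replace_par //; exact: au.
- rewrite qE (subterm_replace _ _ va) => /subterm_substP[[u [ru ur e]]|[p1 [p2 [x [_ rx xs]]]]].
    right=> a' ga'; apply: (usable_trans ua (x := (1, r))); first by rewrite ra in_mset1.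
    apply: (usable_sub ru); case: u ur {ru} e => [//|g' ts' _ [gg _]].
    by apply: usable_root; rewrite -gg.
  left; apply: nf_sub xs; apply: (lhs_vars_nf aP anf).
  by apply: (det_rhs_vars ua ra); rewrite -vars_flat; exists p1.
- rewrite pE in va *; have [w vw] : exists w, subterm v q = Some w.
    by move: va; rewrite subterm_cat; case: (subterm v q) => // w; exists w.
  rewrite (subterm_replace_above _ _ vw); case: w vw => [x|g' us] vw.
    by move: va; rewrite subterm_cat vw.
  move=> [gg _]; subst g'; have [nf|h] := au q g us vw; last by right.
  by case: nn; apply: nf_sub nf _; move: va; rewrite subterm_cat vw; exact.
Qed.

Lemma deferred_redex k v w : deferred k v w -> ~ normal_form P v.
Proof. by case. Qed.

Lemma deferred_init sg k : (k < size (rhs beta))%N ->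
  (forall y, vars rj_tau y -> normal_form P (sg y) /\ flat (sg y) = sg y) ->
  deferred k (subst sg rj_tau) (subst sg (subst sgb (flat (nth (0, rj) (rhs beta) k).2))).
Proof.
move=> kb sgy.
have -> : nth (0, rj) (rhs beta) k = (1, rb).
  by apply/eqP; rewrite -in_mset1 -rbE mem_nth.
have vp : flat (subst sg rj_tau) = subst sg rj_tau by apply: flat_subst => // y /sgy[].
have vE : subst sg rj_tau = subst (fun x => subst sg (sgb x)) (lhs beta).
  by rewrite rj_tauE subst_comp.
split=> //.
- rewrite subst_comp; apply: flat_subst; first exact: flat_flat.
  move=> x; rewrite vars_flat => /(det_rhs_vars beta_usable rbE).
  by rewrite vE in vp; exact: plain_subst_inv vp x.
- move=> p g ts /subterm_substP[[u [ru ur e]]|[p1 [p2 [x [_ rx xs]]]]].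
    right=> a ga; apply: (usable_sub ru); case: u ur {ru} e => [//|g' ts' _ [gg _]].
    by apply: usable_root; rewrite -gg.
  by left; apply: nf_sub xs; apply: (sgy x _).1; exists p1.
- by apply: (redex_not_nf (sg := fun x => subst sg (sgb x)) betaP); rewrite vp vE.
- move=> n u; rewrite vE subst_comp => st nu; apply: (rewrite_first st) => //.
  by rewrite -vE.
Qed.

Lemma dets_nsteps n u p w w' : subterm u p = Some w -> flat w = w -> nsteps n w w' ->
  dets (tree_step P'') n u (replace u p w').
Proof.
elim: n u w => [|n IH] u w uw wp /=; first by move=> <-; rewrite (replace_id uw).
move=> [w1 ww1 w1w']; exists (replace u p w1); last first.
  rewrite -(replace_replace w1 w' uw); apply: (IH _ w1) => //.
    exact: subterm_replace_eq uw.
  exact: dstep_plain ww1.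
exists false; have [q [a [sg [r [ua _ wa anf [ra ->]]]]]] := ww1.
have [aP am] := usable_in ua.
rewrite -(replace_cat _ _ uw).
have ua' : subterm u (p ++ q) = Some (subst sg (lhs a)) by rewrite subterm_cat uw.
apply: (@reduct_step a sg _ u (p ++ q) [:: (1, r)] aP am anf ua').
- exact: plain_sub wp wa.
- by rewrite (pos_ann_cat _ uw); exact: plain_pos_ann.
- by rewrite ra enum_msetn.
Qed.

(** * The simulating system of the deterministic case *)

Section LazySystem.
Context (Q : eqType) (lab : Q -> term S V) (isP : Q -> bool) (succ : Q -> seq (R * Q))
  (sys : system (regular_step P) lab isP succ).
Context (d : Q -> position * adp R S V * (V -> term S V) * seq ((R * term S V) * Q)).
Hypothesis dP : forall x, succ x <> [::] -> node_data lab isP succ x (d x).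

(** The successors of [x] in the order of [zs_], since [matches] compares lists and not
    multisets. *)
Definition lazy_succ x : seq (R * Q) :=
  if nilp (succ x) then [::] else [seq (z.1.1, z.2) | z <- zs_ d x].

Lemma lazy_succ_perm x : perm_eq (lazy_succ x) (succ x).
Proof.
rewrite /lazy_succ; case: ifP => [/nilP -> //|/nilP xn].
by have [] := node_dataP dP xn.
Qed.

Definition lazy_sim x u := exists c, psim deferred c (lab x) u.

Lemma lazy_sim_step x u : lazy_sim x u -> lazy_succ x <> [::] ->
  exists k s, dets (tree_step P'') k u s /\
    ((exists b zs, matches (tree_step P'') isP lazy_succ lazy_sim x b s zs)
     \/ (exists y, [/\ lazy_succ x = [:: (1, y)], ~~ isP x & lazy_sim y s])).
Proof.
move=> [c xu] xn'; have xn : succ x <> [::] by move=> e; rewrite /lazy_succ e in xn'.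
have nx : nilp (succ x) = false by apply/nilP.
have [_ st ba xal _] := node_dataP dP xn; have [aP anf bpi fl [xsa _]] := st.
have [s ts sE] : exists2 s, subterm (lab x) (pi_ d x) = Some s
    & flat s = subst (sg_ d x) (lhs (adp_ d x)).
  by case: (subterm _ (pi_ d x)) fl => //= s [sE]; exists s.
have [[q0 [opi co]]|np] := pselect (exists p, prefix p (pi_ d x) /\ c p <> None).
  case cok : (c q0) co => [k|] // _; have [v [w [xo uo pe ab be]]] := psim_pend xu cok.
  case/prefixP: opi => p piE; have [vp wp au nn vw] := pe.
  have vs : subterm v p = Some s by move: ts; rewrite piE subterm_cat xo.
  have sp := plain_sub vp vs; rewrite sp in sE; rewrite sE in vs.
  have nP : isP x = false.
    by apply/negP => /bpi; rewrite piE (pos_ann_cat _ xo); exact: plain_pos_ann.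
  have am : flag (adp_ d x) = true by rewrite nP in ba.
  have [r [ra st1 au']] := all_usable_step vp au aP am vs anf.
  have [y zsE] : exists y, zs_ d x = [:: ((1, r), y)].
    have := xsa; rewrite ra enum_msetn /= => /perm_small_eq -/(_ isT).
    by case: (zs_ d x) => [|[z y] [|//]] //= [->]; exists y.
  set v' := replace v p _ in st1 au'.
  have sucE : lazy_succ x = [:: (1, y)] by rewrite /lazy_succ nx zsE.
  have labE : lab y = replace (lab x) q0 v'.
    have yz : ((1, r), y) \in zs_ d x by rewrite zsE mem_head.
    by rewrite (node_data_lab dP xn yz) nP reductE am /= piE (replace_cat _ _ xo).
  (* Once the redex has become normal, the contractum catches up by [m] deterministic steps and the
     mark is removed; until then the step is absorbed. *)
  have [nf|nnf] := pselect (normal_form P v').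
    have [|m mst] := vw 1%N v' _ nf; first by exists v'.
    exists m, (replace u q0 v'); split; first exact: dets_nsteps uo wp mst.
    right; exists y; rewrite nP; split=> //; exists (setc c q0 None).
    by rewrite labE -graft_clear //; exact: psim_replace xu xo ab (psim_refl _ _).
  exists 0%N, u; split=> //; right; exists y; rewrite nP; split=> //; exists c.
  have pe' : deferred k v' w.
    split=> //; first exact: dstep_plain st1.
    by move=> n u' st' nu'; apply: (vw n.+1) => //; exists v'.
  have := psim_replace xu xo ab (psim_point pe').
  by rewrite (graft_keep cok be) -labE (replace_id uo).
have np' q : prefix q (pi_ d x) -> c q = None.
  by move=> qpi; case E : (c q) => [k|] //; case: np; exists q; rewrite E.
exists 0%N, u; split=> //; left; have [al|nal] := boolP (alpha_step isP d x).
  have [xP xa [y [zs1 zE]]] := alpha_data dP xn al.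
  rewrite xP xa zE in st; have [g1 g2 g3] := mimic_alpha deferred_redex deferred_init xu st np'.
  have bE : rhs beta = [:: (1, rb)] :> seq _ by rewrite rbE enum_msetn.
  rewrite bE /= mulr1 in g1 g2.
  exists true, (((pj, y), reduct u (pi_ d x) true (flag alpha) (sg_ d x) (rewr (1, rb))) ::
    [seq ((z.1.1, z.2), reduct u (pi_ d x) true (flag alpha) (sg_ d x) z.1.2) | z <- zs1]).
  split=> //.
  - by rewrite /= -map_comp /lazy_succ nx zE.
  - by move: g1; rewrite /= -!map_comp.
  - move=> z; rewrite inE => /predU1P[->|/mapP[z' zz ->]] /=.
      exists (setc c (pi_ d x ++ tau) (Some 0%N)).
      have yz : ((pj, rj), y) \in zs_ d x by rewrite zE mem_head.
      by rewrite (node_data_lab dP xn yz) xP xa; exact: (g2 0%N).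
    exists c; have z'z : z' \in zs_ d x by rewrite zE inE zz orbT.
    by rewrite (node_data_lab dP xn z'z) xP xa; apply: g3; exact: (map_f fst zz).
have nba : ~ (isP x /\ adp_ d x = alpha).
  by move=> [xP xa]; move: nal; rewrite /alpha_step xP xa eqxx.
have [g1 g2] := mimic deferred_redex xu st ba np' nba.
exists (isP x), [seq ((z.1.1, z.2), reduct u (pi_ d x) (isP x) (flag (adp_ d x)) (sg_ d x) z.1.2)
  | z <- zs_ d x]; split=> //.
- by rewrite -map_comp /lazy_succ nx.
- by move: g1; rewrite -!map_comp.
- move=> _ /mapP[z zz ->] /=; exists c; rewrite (node_data_lab dP xn zz); apply: g2.
  exact: (map_f fst zz).
Qed.

Lemma lazy_system x0 : exists (Q' : eqType) (lab' : Q' -> term S V) isP'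
    (succ' : Q' -> seq (R * Q')) x',
  system (tree_step P'') lab' isP' succ' /\
  forall b, (forall n, mass succ n x0 <= b) -> forall n, mass succ' n x' <= b.
Proof.
have [_ rng acc] := sys.
have rngD x y : y \in lazy_succ x -> 0 < y.1 <= 1.
  by rewrite (perm_mem (lazy_succ_perm x)); exact: rng.
have accD x : Acc (Rsucc lazy_succ isP) x.
  elim: (acc x) => y _ IH; constructor=> z [nP [p pz]]; apply: IH; split=> //.
  by exists p; rewrite -(perm_mem (lazy_succ_perm y)).
have x0s : lazy_sim x0 (lab x0) by exists (fun=> None); exact: psim_refl.
have [Q' [lab' [isP' [succ' [x' [sys' mb]]]]]] := simulation rngD accD lazy_sim_step x0s.
exists Q', lab', isP', succ', x'; split=> // b bP; apply: mb => n.
suff -> : mass lazy_succ n x0 = mass succ n x0 by [].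
elim: n x0 {bP x0s} => [|n IH] x.
  by rewrite /mass /nilp (perm_size (lazy_succ_perm x)).
rewrite /= /nilp (perm_size (lazy_succ_perm x)); case: ifP => // _.
by rewrite (perm_big _ (lazy_succ_perm x)) /=; apply: eq_bigr => y _; rewrite IH.
Qed.

End LazySystem.

End Deterministic.

End NonOverlapping.

End Processor.

Theorem theorem23 (R : realType) (S : signature) (V : choiceType)
    (V_infinite : infinite_set [set: V])
    (P P' P'' : {fset adp R S V}) (alpha : adp R S V)
    (P_adp : adp_problem P)
    (alpha_fresh : alpha \notin P')
    (P_split : P = (alpha |` P')%fset)
    (pj : R) (rj : term S V) (rj_in : (pj, rj) \in rhs alpha)
    (tau : position) (rj_tau : term S V)
    (tau_def : pos_def rj tau)
    (rj_tau_def : subterm rj tau = Some rj_tau)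
    (rj_tau_plain : unannotated rj_tau)
    (beta : adp R S V) (qe : {mset (R * term S V)%type})
    (rj_step : tstep_by P beta rj tau qe)
    (P''_def : P'' = (P' `|` [fset flat_adp alpha; rewritten_adp alpha pj rj qe])%fset)
    (conditions :
      [\/ [/\ non_overlapping (usable P rj_tau), linear_adp beta & non_erasing beta],
          non_overlapping (usable P rj_tau) /\
            (forall a, usable P rj_tau a -> deterministic a)
        | [/\ non_overlapping (usable P rj_tau), ground rj_tau
            & istep P rj tau qe]]) :
  iAST P'' -> iAST P.
Proof.
move=> astP'' T.
have plain : flat rj_tau = rj_tau by apply/unann_flatP.
have [sgb [betaP beta_true [_ fl qeE]]] := rj_step.
have rj_tauE : rj_tau = subst sgb (lhs beta) by move: fl; rewrite rj_tau_def /= plain => -[].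
have nann : `[< pos_ann rj tau >] = false.
  apply/asboolPn; rewrite -[tau]cats0 (pos_ann_cat _ rj_tau_def); exact: plain_pos_ann.
rewrite nann beta_true in qeE.
have [isP0 sys0 sum0] := tree_system T P_adp.
have [_ rng0 _] := sys0.
(* Leaf masses never exceed 1, so a counterexample has a finite leaf mass strictly below 1, which
   becomes the bound [b]. *)
have le1 : (leaf_mass T <= 1%:E)%E.
  by apply: leaf_mass_le => n; apply: mass_le1 => // v y /rng0/andP[/ltW].
apply: contrapT => /eqP ne1.
have lt1 : (leaf_mass T < 1%:E)%E by rewrite lt_neqAle ne1 le1.
have ge0 : (0 <= leaf_mass T)%E.
  by apply: le_trans (mass_le_leaf_mass T 0); rewrite lee_fin mass_ge0 // => v y /rng0/andP[/ltW].
have [b bE] : exists b, leaf_mass T = b%:E.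
  by case: (leaf_mass T) lt1 ge0 => [b||] // _ _; exists b.
have [Q [lab [isP [succ [x0 [sys mb]]]]]] := regular_system P_adp (troot T) sys0 sum0.
have mbb n : mass succ n x0 <= b.
  by move: n; apply: mb => m; rewrite -lee_fin -bE; exact: mass_le_leaf_mass.
have [d dP] : exists d, forall x, succ x <> [::] ->
    node_data P alpha pj rj beta lab isP succ x (d x).
  suff /choice[d dP] : forall x, exists d, succ x <> [::] ->
      node_data P alpha pj rj beta lab isP succ x d by exists d.
  move=> x; have [x0E|xn] := pselect (succ x = [::]).
    (* An arbitrary value for leaves, where no step data exist. *)
    by exists (tau, alpha, Var, [::]).
  by have [d dx] := node_data_ex rj_in beta sys xn; exists d.
suff [Q' [lab' [isP' [succ' [x' [sys' mb']]]]]] :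
    exists (Q' : eqType) (lab' : Q' -> term S V) isP' (succ' : Q' -> seq (R * Q')) x',
    system (tree_step P'') lab' isP' succ' /\
    forall b, (forall n, mass succ n x0 <= b) -> forall n, mass succ' n x' <= b.
  (* The unfolded tree would have leaf mass at most [b], against [P''] being iAST. *)
  have [T' T'm] := realise sys' x'.
  have : (leaf_mass T' <= b%:E)%E.
    by apply: leaf_mass_le => n; rewrite T'm; exact: mb' mbb n.
  by rewrite astP'' -bE leNgt lt1.
case: conditions => [[no lin ne]|[no det]|[no gr st]].
- exact: (eager_system P_adp P_split rj_in rj_tau_def plain betaP beta_true rj_tauE qeE
    P''_def V_infinite no sys (or_introl (conj lin ne)) dP).
(* [beta] is usable, being applied at the root of [rj_tau], and hence has a single outcome. *)
- have [_ [rb rbE]] := det _ (beta_usable P_adp betaP beta_true rj_tauE).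
  exact: (lazy_system P_adp P_split rj_in rj_tau_def plain betaP beta_true rj_tauE qeE
    P''_def V_infinite no det rbE sys dP).
- have anf : ANF P rj_tau.
    have [a [sg [_ anf [_ fla _]]]] := st.
    by move: fla; rewrite rj_tau_def /= plain => -[->].
  exact: (eager_system P_adp P_split rj_in rj_tau_def plain betaP beta_true rj_tauE qeE
    P''_def V_infinite no sys (or_intror (conj gr anf)) dP).
Qed.
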